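(* Let $\boldsymbol{\gamma}=(\gamma_1,\gamma_2,\ldots)\in(0,\infty)^{\mathbb N}$ be a non-increasing sequence of weights and let $\boldsymbol{\alpha}=(\alpha_1,\alpha_2,\ldots)\in(1,\infty)^{\mathbb N}$ be a sequence of smoothness parameters such that $\inf_d\alpha_d>1$. Then multivariate integration in the weighted Hermite spaces $\mathcal H_{\boldsymbol p_{\boldsymbol\alpha,\boldsymbol\gamma}}$ of functions with polynomially decaying coefficients is 1. strongly polynomially tractable, if $\sum_{j=1}^\infty\gamma_j<\infty$; 2. polynomially tractable, if $\limsup_{d\to\infty}\frac{\sum_{j=1}^d\gamma_j}{\ln(d)}<\infty$.
   Context: Let $\varphi_d(\boldsymbol x)=(2\pi)^{-d/2}e^{-\boldsymbol x^\top\boldsymbol x/2}$ be the standard Gaussian density on $\mathbb R^d$ ($\varphi=\varphi_1$). For $k\in\mathbb N_0$ let $H_k(x)=\frac{(-1)^k}{\sqrt{k!}}e^{x^2/2}\frac{d^k}{dx^k}e^{-x^2/2}$ and for $\boldsymbol k\in\mathbb N_0^d$ let $H_{\boldsymbol k}(\boldsymbol x)=\prod_{j=1}^dH_{k_j}(x_j)$; these form an orthonormal basis of $L^2(\mathbb R^d,\varphi_d)$. For $f\in L^2(\mathbb R^d,\varphi_d)$ put $\hat f(\boldsymbol k)=\int_{\mathbb R^d}f(\boldsymbol x)H_{\boldsymbol k}(\boldsymbol x)\varphi_d(\boldsymbol x)\,d\boldsymbol x$. For a summable function $\boldsymbol r:\mathbb N_0^d\to(0,\infty)$ let $\|f\|_{\boldsymbol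 r}=\big(\sum_{\boldsymbol k\in\mathbb N_0^d}\boldsymbol r(\boldsymbol k)^{-1}|\hat f(\boldsymbol k)|^2\big)^{1/2}$; the Hermite space $\mathcal H_{\boldsymbol r}$ is the space of continuous functions $f:\mathbb R^d\to\mathbb R$ that are square-integrable with respect to $\varphi_d\,d\boldsymbol x$ and satisfy $\|f\|_{\boldsymbol r}<\infty$. In dimension $d$, the space $\mathcal H_{\boldsymbol p_{\boldsymbol\alpha,\boldsymbol\gamma}}$ is the Hermite space with $\boldsymbol r(\boldsymbol k)=\boldsymbol p_{\boldsymbol\alpha,\boldsymbol\gamma}(\boldsymbol k)=\prod_{j=1}^dp_{\alpha_j,\gamma_j}(k_j)$, where $p_{\alpha,\gamma}(0)=1$ and $p_{\alpha,\gamma}(k)=\gamma k^{-\alpha}$ for $k\ge1$ (for each $d$ only the first $d$ entries of the sequences $\boldsymbol\alpha,\boldsymbol\gamma$ are used). For a point set $\mathcal P=\{\boldsymbol x_1,\ldots,\boldsymbol x_n\}\subset\mathbb R^d$ the worst case error of quasi-Monte Carlo (QMC) integration is $e_{n,d}(\mathcal P,\mathcal H_{\boldsymbol r})=\sup_{f\in\mathcal H_{\boldsymbol r},\,\|f\|_{\boldsymbol r}\le1}\big|\int_{\mathbb R^d}f(\boldsymbol x)\varphi_d(\boldsymbol x)\,d\boldsymbol x-\frac1n\sum_{i=1}^nf(\boldsymbol x_i)\big|$. The information complexity is $n_{\min}(\varepsilon,d;\mathcal H_{\boldsymbol r})=\min\{n:\exists\,\mathcal P\text{ with }n\text{ points such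 that }e_{n,d}(\mathcal P,\mathcal H_{\boldsymbol r})\le\varepsilon\,\boldsymbol r(\boldsymbol 0)\}$; here $\boldsymbol r(\boldsymbol 0)=1$. Integration is polynomially tractable if there are $c,p,q>0$ such that $n_{\min}(\varepsilon,d;\mathcal H_{\boldsymbol r})\le c\,d^q\varepsilon^{-p}$ for all $d\in\mathbb N$ and all $\varepsilon\in(0,1)$; it is strongly polynomially tractable if this holds with $q=0$. *)

(* Defs.v *)
From HB Require Import structures.
From mathcomp Require Import all_boot all_order all_algebra.
From mathcomp Require Import all_classical all_reals all_analysis.

Set Implicit Arguments.
Unset Strict Implicit.
Unset Printing Implicit Defensive.

Import Order.TTheory GRing.Theory Num.Theory.
Import numFieldTopology.Exports numFieldNormedType.Exports.

Local Open Scope classical_set_scope.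
Local Open Scope ring_scope.

Section lebesgue_cons.
Context {R : realType} (d : nat).
Local Notation T := (measurableTypeR R).
Variable m : {sigma_finite_measure set (d.-tuple T) -> \bar R}.

Let cons_pair (p : T * d.-tuple T) : d.+1.-tuple T := [tuple of p.1 :: p.2].

Let measurable_cons_pair : measurable_fun setT cons_pair.
Proof. exact: measurable_cons. Qed.

(* The image on R^(d+1) of the product of the Lebesgue measure on R by m. *)
Definition lebesgue_cons : set (d.+1.-tuple T) -> \bar R :=
  pushforward (lebesgue_measure \x m)%E cons_pair.

Let lebesgue_cons0 : lebesgue_cons set0 = 0%E.
Proof. exact: measure0. Qed.

Let lebesgue_cons_ge0 A : (0 <= lebesgue_cons A)%E.
Proof. exact: measure_ge0. Qed.

Let lebesgue_cons_sigma_additive : semi_sigma_additive lebesgue_cons.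
Proof. exact: measure_semi_sigma_additive. Qed.

HB.instance Definition _ := isMeasure.Build _ _ _ lebesgue_cons
  lebesgue_cons0 lebesgue_cons_ge0 lebesgue_cons_sigma_additive.

Let lebesgue_cons_sigma_finite : sigma_finite setT lebesgue_cons.
Proof.
have /sigma_finiteP[F [TF ndF Foo]] :=
  sigma_finiteT (@lebesgue_measure R : {sigma_finite_measure set T -> \bar R}).
have /sigma_finiteP[G [TG ndG Goo]] := sigma_finiteT m.
pose uncons (t : d.+1.-tuple T) := (thead t, [tuple of behead t]).
have consK : cancel cons_pair uncons.
  by move=> [a t]; rewrite /uncons /cons_pair theadE; congr pair; exact/val_inj.
have muncons : measurable_fun setT uncons.
  apply/measurable_fun_pairP; split; first exact: measurable_tnth.
  exact: measurable_behead.
exists (fun n => uncons @^-1` (F n `*` G n)).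
  rewrite -preimage_bigcup -[LHS](preimage_setT uncons); congr preimage.
  apply/seteqP; split => // -[x y] _.
  have [i _ Fx] : (\bigcup_i F i) x by rewrite -TF.
  have [j _ Gy] : (\bigcup_i G i) y by rewrite -TG.
  exists (maxn i j) => //; split => /=.
    by move: x Fx; exact/subsetPset/ndF/leq_maxl.
  by move: y Gy; exact/subsetPset/ndG/leq_maxr.
move=> n; have [mF Fn] := Foo n; have [mG Gn] := Goo n; split.
  by rewrite -[X in measurable X]setTI; apply: muncons => //; exact: measurableX.
rewrite /lebesgue_cons /pushforward -comp_preimage (_ : _ \o _ = id).
  by rewrite preimage_id product_measure1E// lte_mul_pinfty// ge0_fin_numE.
by apply/funext => p; exact: consK.
Qed.

HB.instance Definition _ := Measure_isSigmaFinite.Build _ _ _ lebesgue_cons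
  lebesgue_cons_sigma_finite.

End lebesgue_cons.

(* The Lebesgue measure on R^d, as an iterated product. *)
Fixpoint lebesgue_tuple (R : realType) (d : nat) :
    {sigma_finite_measure set (d.-tuple (measurableTypeR R)) -> \bar R} :=
  match d with
  | 0 => dirac ([tuple] : 0.-tuple (measurableTypeR R))
  | d'.+1 => lebesgue_cons (lebesgue_tuple R d')
  end.

(* Points of R^d are row vectors, which carry the topology; the measurable
   structure is only available on tuples, whence this conversion. *)
Definition row_of_tuple (R : realType) (d : nat)
    (t : d.-tuple (measurableTypeR R)) : 'rV[R]_d := \row_(i < d) tnth t i.

Section hermite.
Context {R : realType}.

Definition gauss_density (d : nat) (x : 'rV[R]_d) : R :=
  (2 * pi) `^ (- (d%:R / 2)) * expR (- (\sum_(i < d) x 0 i ^+ 2) / 2).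

Definition gauss_integrable (d : nat) (f : 'rV[R]_d -> R) : Prop :=
  (lebesgue_tuple R d).-integrable setT
    (fun t => (f (row_of_tuple t) * gauss_density (row_of_tuple t))%:E).

Definition gauss_integral (d : nat) (f : 'rV[R]_d -> R) : R :=
  \int[lebesgue_tuple R d]_t
    (f (row_of_tuple t) * gauss_density (row_of_tuple t)).

Definition hermite1 (k : nat) (x : R) : R :=
  (-1) ^+ k / Num.sqrt k`!%:R * expR (x ^+ 2 / 2) *
  derive1n k (fun y : R => expR (- y ^+ 2 / 2)) x.

Definition hermite (d : nat) (k : {ffun 'I_d -> nat}) (x : 'rV[R]_d) : R :=
  \prod_(j < d) hermite1 (k j) (x 0 j).

Definition hermite_coef (d : nat) (f : 'rV[R]_d -> R)
    (k : {ffun 'I_d -> nat}) : R :=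
  gauss_integral (fun x => f x * hermite k x).

Definition hermite_norm (d : nat) (r : {ffun 'I_d -> nat} -> R)
    (f : 'rV[R]_d -> R) : \bar R :=
  sqrte (\esum_(k in [set: {ffun 'I_d -> nat}])
           ((r k)^-1 * `|hermite_coef f k| ^+ 2)%:E).

Definition hermite_space (d : nat) (r : {ffun 'I_d -> nat} -> R) :
    set ('rV[R]_d -> R) :=
  [set f : 'rV[R]_d -> R | [/\ continuous f,
      gauss_integrable (fun x => f x ^+ 2) & (hermite_norm r f < +oo)%E]].

(* A point set is an indexed family: repeated points are allowed, as usual for
   QMC rules. *)
Definition qmc_error (d n : nat) (r : {ffun 'I_d -> nat} -> R)
    (x : 'I_n -> 'rV[R]_d) : \bar R :=
  ereal_sup [set `|gauss_integral f - n%:R^-1 * \sum_(i < n) f (x i)|%:E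
            | f in [set f | hermite_space r f /\ (hermite_norm r f <= 1)%E]].

(* The infimum of a set of naturals is its minimum, or +oo if it is empty. *)
Definition n_min (d : nat) (r : {ffun 'I_d -> nat} -> R) (eps : R) : \bar R :=
  ereal_inf [set n%:R%:E | n in [set n : nat | (0 < n)%N /\
    exists x : 'I_n -> 'rV[R]_d,
      (qmc_error r x <= (eps * r [ffun=> 0%N])%:E)%E]].

Definition n_min_bound (r : forall d, {ffun 'I_d -> nat} -> R) (c p q : R) :
    Prop :=
  forall (d : nat) (eps : R), (0 < d)%N -> 0 < eps < 1 ->
    (n_min (@r d) eps <= (c * d%:R `^ q * eps `^ (- p))%:E)%E.

Definition polynomially_tractable (r : forall d, {ffun 'I_d -> nat} -> R) :
    Prop :=
  exists c p q : R, [/\ 0 < c, 0 < p, 0 < q & n_min_bound r c p q].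

Definition strongly_polynomially_tractable
    (r : forall d, {ffun 'I_d -> nat} -> R) : Prop :=
  exists c p : R, [/\ 0 < c, 0 < p & n_min_bound r c p 0].

Definition poly_decay1 (a g : R) (k : nat) : R :=
  if k == 0%N then 1 else g * k%:R `^ (- a).

(* Sequences are indexed from 0: alpha j and gamma j are the parameters of the
   (j+1)-st coordinate. *)
Definition poly_decay (alpha gamma : nat -> R) (d : nat)
    (k : {ffun 'I_d -> nat}) : R :=
  \prod_(j < d) poly_decay1 (alpha j) (gamma j) (k j).

End hermite.

(* Main.v *)
Require Import Defs.
From HB Require Import structures.
From mathcomp Require Import all_boot all_order all_algebra.
From mathcomp Require Import all_classical all_reals all_analysis.
From mathcomp Require Import measurable_realfun.
From mathcomp Require Import ring lra.

(** The worst-case error of the points x_1, ..., x_n is at most D / n, where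
    D^2 = sum_{k <> 0} r(k) (sum_i H_k(x_i))^2.  Adding a point x changes D^2 by
    2 sum r(k) S_k H_k(x) + sum r(k) H_k(x)^2, whose Gaussian mean is at most
    sum_k r(k) - 1; so points can be picked one by one with
    D^2 <= n sum_k r(k) <= n exp (Z sum_j gamma_j), Z being the value of a zeta
    function at inf alpha.  Hence n of order exp (Z sum_j gamma_j) / eps^2
    points suffice.

    The error bound needs f(x_i) to be recovered from the Hermite coefficients
    of f at every x_i.  Instead of the expansion of f, consider its Abel means
    sum_k rho^|k| fhat(k) H_k(x): by Mehler's formula they are the averages of f
    against a Gaussian concentrated near x, hence tend to f(x) when rho tends
    to 1, for every continuous square-integrable f and every x. *)

Set Implicit Arguments.
Unset Strict Implicit.
Unset Printing Implicit Defensive.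

Import Order.TTheory GRing.Theory Num.Theory.
Import numFieldTopology.Exports numFieldNormedType.Exports.

Local Open Scope classical_set_scope.
Local Open Scope ring_scope.

(** The Hermite coefficients determine f only almost everywhere, whereas the points form a null set.
    Continuity of f must bridge this gap, and it acts through an averaging kernel, for which
    Mehler's formula supplies a closed form. The factor rho^|k| is at most 1, so the Cauchy-Schwarz
    bound holds for the Abel means uniformly in rho and survives the limit rho -> 1. It also makes
    the series in each coordinate converge absolutely as soon as H_k(x) grows in k more slowly than
    every t^k with t > 1, which the three-term recurrence alone provides. D^2 is never formed as an
    infinite sum: only its truncations to the cubes {0, ..., N-1}^d occur, with bounds uniform in N.
    A new point must therefore serve all N at once, and monotone convergence yields it. *)

(** * Hermite polynomials and their three-term recurrence *)

Section hermite_polynomials.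
Context {R : realType}.
Implicit Types x y : R.

(** The monic (probabilists') Hermite polynomials; the recursion is what differentiating [hpoly k]
    times exp(-x^2/2) produces, up to sign. *)
Fixpoint hpoly (k : nat) : {poly R} :=
  if k is k'.+1 then 'X * hpoly k' - (hpoly k')^`() else 1.

Lemma deriv_hpolyS k : (hpoly k.+1)^`() = hpoly k *+ k.+1.
Proof.
elim: k => [|k IH]; first by rewrite /= mulr1 -polyC1 derivC subr0 derivX.
rewrite [in LHS]/= derivB derivM derivX mul1r -/(hpoly k.+1) IH derivMn.
rewrite mulrnAr [RHS]mulrS -addrA -mulrnBl; congr (_ + _ *+ _).
Qed.

Lemma hpoly_rec k : hpoly k.+2 = 'X * hpoly k.+1 - hpoly k *+ k.+1.
Proof. by rewrite -deriv_hpolyS. Qed.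

Lemma is_derive_gauss (x : R) :
  is_derive x 1 (fun y : R => expR (- y ^+ 2 / 2)) (- x * expR (- x ^+ 2 / 2)).
Proof.
by apply: is_derive_eq; rewrite /GRing.scale /=; field.
Qed.

Lemma derive1n_gauss k :
  derive1n k (fun y : R => expR (- y ^+ 2 / 2)) =
  (fun x => (-1) ^+ k * (hpoly k).[x] * expR (- x ^+ 2 / 2)).
Proof.
elim: k => [|k IH].
  by apply/funext => x; rewrite derive1n0 /= !hornerE.
rewrite derive1nS IH; apply/funext => x; rewrite derive1E.
have D := is_derive_gauss x; have Dp := is_derive_poly (hpoly k) x.
rewrite (_ : (fun y => _) =
  (fun y => (-1) ^+ k *: ((hpoly k).[y] * expR (- y ^+ 2 / 2)))); last first.
  by apply/funext => y; rewrite /GRing.scale /= mulrA.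
rewrite derive_val /= !hornerE /GRing.scale /= [(-1) ^+ _.+1]exprS; ring.
Qed.

Lemma hermite1E k x : hermite1 k x = (hpoly k).[x] / Num.sqrt k`!%:R.
Proof.
rewrite /hermite1 derive1n_gauss.
have E : expR (x ^+ 2 / 2) * expR (- x ^+ 2 / 2) = 1.
  by rewrite -expRD -mulrDl subrr mul0r expR0.
have s2 : (-1 : R) ^+ k * (-1) ^+ k = 1 by rewrite -exprMn mulrNN mulr1 expr1n.
transitivity ((-1) ^+ k * (-1) ^+ k * (expR (x ^+ 2 / 2) * expR (- x ^+ 2 / 2)) *
  ((hpoly k).[x] / Num.sqrt k`!%:R)); last by rewrite s2 E !mul1r.
by move: (_ ^+ k) (Num.sqrt _)^-1 (expR _) (expR _) (_.[x]) => *; ring.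
Qed.

Lemma hermite1_0 x : hermite1 0 x = 1.
Proof. by rewrite hermite1E hornerE fact0 sqrtr1 divr1. Qed.

Lemma hermite1_1 x : hermite1 1 x = x.
Proof. by rewrite hermite1E /= -polyC1 derivC subr0 mulr1 hornerX sqrtr1 divr1. Qed.

(** At [k = 0] the convention [0.-1 = 0] is harmless, since the coefficient [Num.sqrt 0%:R] kills
    the term. *)
Lemma hermite1_rec k x :
  Num.sqrt k.+1%:R * hermite1 k.+1 x =
  x * hermite1 k x - Num.sqrt k%:R * hermite1 k.-1 x.
Proof.
case: k => [|k].
  by rewrite hermite1_0 hermite1_1 sqrtr0 sqrtr1 mul0r subr0 mulr1 mul1r.
rewrite /= !hermite1E hpoly_rec !factS !natrM !sqrtrM ?ler0n //.
have s0 n : Num.sqrt (n.+1%:R : R) != 0 by rewrite sqrtr_eq0 -ltNge ltr0n.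
have f0 : Num.sqrt (k`!%:R : R) != 0 by rewrite sqrtr_eq0 -ltNge ltr0n fact_gt0.
rewrite hornerD hornerN hornerMn hornerM hornerX.
have E : k.+1%:R = Num.sqrt k.+1%:R ^+ 2 :> R by rewrite sqr_sqrtr// ler0n.
rewrite -[_ *+ k.+1]mulr_natr; move: (s0 k.+1) (s0 k) f0 E.
move: (Num.sqrt k.+2%:R) (Num.sqrt k.+1%:R) (Num.sqrt k`!%:R) => a b c a0 b0 c0 ->.
move: (hpoly k.+1).[x] (hpoly k).[x] => u v.
by field; rewrite a0 b0 c0.
Qed.

End hermite_polynomials.

(** * Power series of radius of convergence at least 1 *)

Section subexponential.
Context {R : realType}.
Implicit Types (u v : R^nat) (r t : R).

(** Equivalent to radius of convergence at least 1, but in a form visibly stable under shifts,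
    formal differentiation and termwise products of coefficients (split t as sqrt t * sqrt t). *)
Definition subexponential u :=
  forall t, 1 < t -> exists C : R, forall k, `|u k| <= C * t ^+ k.

Lemma subexponential_le u v : (forall k, `|u k| <= `|v k|) ->
  subexponential v -> subexponential u.
Proof.
move=> uv sv t /sv[C vC]; exists C => k; exact: le_trans (uv k) (vC k).
Qed.

Lemma subexponentialD u v : subexponential u -> subexponential v ->
  subexponential (fun k => u k + v k).
Proof.
move=> su sv t t1; have [C uC] := su t t1; have [C' vC] := sv t t1.
exists (C + C') => k; rewrite mulrDl.
by rewrite (le_trans (ler_normD _ _))// lerD.
Qed.

Lemma subexponentialM u v : subexponential u -> subexponential v ->
  subexponential (fun k => u k * v k).
Proof.
move=> su sv t t1.
have t0 : 0 <= t by rewrite (le_trans ler01)// ltW.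
have s1 : 1 < Num.sqrt t by rewrite -sqrtr1 ltr_sqrt// (lt_trans ltr01).
have [C uC] := su _ s1; have [C' vC] := sv _ s1.
exists (C * C') => k; rewrite normrM -[in leRHS](sqr_sqrtr t0) expr2 exprMn mulrACA.
by apply: ler_pM.
Qed.

Lemma subexponentialZ c u : subexponential u ->
  subexponential (fun k => c * u k).
Proof.
by move=> su t /su[C uC]; exists (`|c| * C) => k; rewrite normrM -mulrA ler_wpM2l.
Qed.

Lemma subexponential_shift u : subexponential u ->
  subexponential (fun k => u k.+1).
Proof.
move=> su t t1; have [C uC] := su t t1; exists (C * t) => k.
by rewrite -mulrA -exprS.
Qed.

Lemma subexponential_pred u : subexponential u ->
  subexponential (fun k => u k.-1).
Proof.
move=> su t t1; have [C uC] := su t t1; exists C => k.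
rewrite (le_trans (uC _))// ler_wpM2l//.
  by have := uC 0%N; rewrite expr0 mulr1; apply: le_trans.
by rewrite ler_weXn2l ?ltW// leq_pred.
Qed.

Lemma subexponential_nat : subexponential (fun k => k%:R).
Proof.
move=> t t1; exists (t - 1)^-1 => k; rewrite ger0_norm//.
rewrite ler_pdivlMl ?subr_gt0//.
have t0 : 0 <= t by rewrite (le_trans ler01)// ltW.
elim: k => [|k IH]; first by rewrite mulr0 expr0.
rewrite exprS -natr1 mulrDr mulr1.
have : (t - 1) * k%:R <= t ^+ k by [].
have : 1 <= t ^+ k by rewrite exprn_ege1// ltW.
by move: (t ^+ k) ((t - 1) * _) => p q; nra.
Qed.

Lemma subexponential_diffs u : subexponential u ->
  subexponential (pseries_diffs u).
Proof.
move=> su; apply: subexponentialM; last exact: subexponential_shift.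
exact: (subexponential_shift subexponential_nat).
Qed.

Lemma subexponential_ratio u : (forall k, 0 <= u k) ->
  (forall t, 1 < t -> exists K, forall k, (K <= k)%N -> u k.+1 <= t * u k) ->
  subexponential u.
Proof.
move=> u0 H t t1; have [K HK] := H t t1.
have t0 : 0 <= t by rewrite (le_trans ler01)// ltW.
(* The sum dominates every initial value up to index K, where the ratio bound takes over. *)
exists (\sum_(i < K.+1) u i) => k; rewrite ger0_norm//.
have le i : (i < K.+1)%N -> u i <= \sum_(i < K.+1) u i.
  by move=> iK; rewrite (bigD1 (Ordinal iK))//= lerDl sumr_ge0.
have C0 : 0 <= \sum_(i < K.+1) u i by rewrite sumr_ge0.
elim: k => [|k IH]; first by rewrite expr0 mulr1 le.
have [kK|Kk] := ltnP k K.
  by rewrite (le_trans (le _ _))// ler_peMr// exprn_ege1// ltW.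
by rewrite (le_trans (HK _ Kk))// exprS mulrCA ler_wpM2l.
Qed.

Definition psum u r := limn (pseries u r).

Lemma is_cvg_psum u r : subexponential u -> `|r| < 1 ->
  cvgn [series `|u k * r ^+ k|]_k.
Proof.
move=> su r1.
(* Any t strictly between 1 and 1/|r| gives a convergent geometric majorant; the midpoint is
   taken. *)
have [t t1 tr] : exists2 t, 1 < t & t * `|r| < 1.
  have [r0|r0] := eqVneq `|r| 0; first by exists 2; rewrite ?ltr1n// r0 mulr0.
  have {r0} r0 : 0 < `|r| by rewrite lt0r r0 normr_ge0.
  have s1 : 1 < `|r|^-1 by rewrite invf_gt1.
  exists ((1 + `|r|^-1) / 2); first by lra.
  by rewrite mulrAC mulrDl mulVf ?gt_eqF//; lra.
have t0 : 0 <= t by rewrite (le_trans ler01)// ltW.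
have [C uC] := su _ t1.
apply: (@series_le_cvg _ _ (geometric C (t * `|r|))) => [k|k|k|].
- exact: normr_ge0.
- rewrite /=; apply: mulr_ge0; last by rewrite exprn_ge0// mulr_ge0.
  by have := uC 0%N; rewrite expr0 mulr1; apply: le_trans.
- by rewrite /= normrM normrX exprMn mulrA ler_wpM2r// exprn_ge0.
- by apply: is_cvg_geometric_series; rewrite ger0_norm// mulr_ge0.
Qed.

Lemma cvg_psum u r : subexponential u -> `|r| < 1 ->
  pseries u r @ \oo --> psum u r.
Proof. by move=> su r1; apply: normed_cvg; exact: is_cvg_psum. Qed.

Lemma psum_unique u r l : pseries u r @ \oo --> l -> psum u r = l.
Proof. exact: cvg_lim. Qed.

Lemma psumD u v r : subexponential u -> subexponential v -> `|r| < 1 ->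
  psum (fun k => u k + v k) r = psum u r + psum v r.
Proof.
move=> su sv r1; apply: psum_unique.
rewrite (_ : pseries _ _ = pseries u r + pseries v r); last first.
  apply/funext => n; rewrite fctE /pseries /series/= -big_split/=.
  by apply: eq_bigr => i _; rewrite mulrDl.
by apply: cvgD; exact: cvg_psum.
Qed.

Lemma psumZ c u r : subexponential u -> `|r| < 1 ->
  psum (fun k => c * u k) r = c * psum u r.
Proof.
move=> su r1; apply: psum_unique.
rewrite (_ : pseries _ _ = (fun n => c * pseries u r n)); last first.
  apply/funext => n; rewrite /pseries /series/= mulr_sumr.
  by apply: eq_bigr => i _; rewrite mulrA.
by apply: cvgMr; exact: cvg_psum.
Qed.

Lemma psum_shift u r : subexponential u -> `|r| < 1 ->
  psum u r = u 0%N + r * psum (fun k => u k.+1) r.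
Proof.
move=> su r1; apply: psum_unique; rewrite -cvg_shiftS.
rewrite (_ : (fun n => _) = (fun n => u 0%N + r * pseries (fun k => u k.+1) r n)); last first.
  apply/funext => n; rewrite /pseries/= /series /= big_nat_recl//= expr0 mulr1.
  congr (_ + _); rewrite mulr_sumr.
  by apply: eq_bigr => i _; rewrite exprS mulrCA.
apply: cvgD; first exact: cvg_cst.
by apply: cvgMr; apply: cvg_psum => //; exact: subexponential_shift.
Qed.

Lemma is_derive_psum u r : subexponential u -> `|r| < 1 ->
  is_derive r 1 (psum u) (psum (pseries_diffs u) r).
Proof.
(* Termwise differentiation at r asks for convergence of the series and of its first two formal
   derivatives at some radius between |r| and 1. *)
move=> su r1; pose K := (1 + `|r|) / 2.
have K0 : 0 <= K by rewrite divr_ge0// addr_ge0.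
have rK : `|r| < K by rewrite /K; lra.
have K1 : `|K| < 1 by rewrite ger0_norm// /K; lra.
have cv v : subexponential v -> cvgn (pseries v K).
  by move=> sv; apply/cvg_ex; exists (psum v K); exact: cvg_psum.
apply: (@pseries_snd_diffs _ u K).
- exact: cv.
- exact/cv/subexponential_diffs.
- by apply/cv/subexponential_diffs/subexponential_diffs.
- by rewrite [ltRHS]ger0_norm.
Qed.

End subexponential.

(** * Mehler's formula in one variable *)

Section mehler.
Context {R : realType}.
Implicit Types (x y r : R).

(** The maximum m of two consecutive values turns the second-order recurrence into a first-order
    inequality: after division by sqrt (k+2) the new value is at most (|x| / sqrt (k+2) + 1) m,
    hence at most t m once sqrt (k+2) >= |x| / (t - 1). *)
Lemma subexponential_hermite1 x : subexponential (hermite1 ^~ x).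
Proof.
pose m k := Num.max `|hermite1 k.+1 x| `|hermite1 k x|.
apply: (@subexponential_le _ _ m) => [k|].
  by rewrite [leRHS]ger0_norm ?le_max ?lexx ?orbT ?normr_ge0.
apply: subexponential_ratio => [k|t t1]; first by rewrite le_max normr_ge0.
have t0 : 0 < t - 1 by rewrite subr_gt0.
pose K := Num.Def.truncn ((`|x| / (t - 1)) ^+ 2).
exists K => k Kk.
have s0 n : 0 < Num.sqrt (n.+1%:R : R) by rewrite sqrtr_gt0 ltr0n.
have m0 : 0 <= m k by rewrite le_max normr_ge0.
have H : `|x| <= (t - 1) * Num.sqrt k.+2%:R.
  rewrite -ler_pdivrMl// mulrC -(ger0_norm (_ : 0 <= `|x| / (t - 1))); last first.
    by rewrite divr_ge0// ltW.
  rewrite -sqrtr_sqr ler_sqrt// ltW// (lt_le_trans (truncnS_gt _))//.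
  by rewrite ler_nat ltnS (leq_trans Kk).
rewrite {1}/m ge_max; apply/andP; split; last first.
  rewrite (@le_trans _ _ (m k)) ?le_max ?lexx//.
  by rewrite ler_peMl// ltW.
rewrite -(ler_pM2l (s0 k.+1)) -{1}(gtr0_norm (s0 k.+1)) -normrM hermite1_rec /=.
rewrite (le_trans (ler_normB _ _))// (normrM x) (normrM (Num.sqrt _)) (gtr0_norm (s0 k)).
have mk : `|hermite1 k x| <= m k by rewrite le_max lexx orbT.
have mk1 : `|hermite1 k.+1 x| <= m k by rewrite le_max lexx.
have ss : Num.sqrt k.+1%:R <= Num.sqrt k.+2%:R :> R by rewrite ler_sqrt ?ler_nat.
rewrite (_ : _ * (t * m k) =
  (t - 1) * Num.sqrt k.+2%:R * m k + Num.sqrt k.+2%:R * m k); last by ring.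
by apply: lerD; apply: ler_pM; rewrite ?normr_ge0//; exact: ltW.
Qed.

Lemma subexponential_sqrt : subexponential (fun k => Num.sqrt k%:R : R).
Proof.
apply: (@subexponential_le _ _ (fun k => k%:R)) => [[|k]|].
- by rewrite sqrtr0.
- rewrite !ger0_norm ?sqrtr_ge0// -[leRHS](ger0_norm (ler0n _ _)) -sqrtr_sqr.
  by rewrite ler_sqrt// expr2 ler_peMl// ler1n.
- exact: subexponential_nat.
Qed.

(** The transition density of the Ornstein-Uhlenbeck semigroup at time - ln r, relative to the
    Gaussian measure. *)
Definition mehler r x y : R :=
  (Num.sqrt (1 - r ^+ 2))^-1 *
  expR ((2 * r * x * y - r ^+ 2 * (x ^+ 2 + y ^+ 2)) / (2 * (1 - r ^+ 2))).

(* The generating function A of [hermite1 k x * hermite1 k y] satisfies a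
   first-order linear differential equation in r: the three-term recurrence
   expresses A' through A and the generating functions P, Q of
   [sqrt k * hermite1 k x * hermite1 k.-1 y] and its mirror image, and P, Q
   through A. *)
Lemma mehler_ode x y r : `|r| < 1 ->
  let a k := hermite1 k x * hermite1 k y in
  (1 - r ^+ 2) ^+ 2 * psum (pseries_diffs a) r =
  (r * (1 - r ^+ 2) + x * y * (1 + r ^+ 2) - r * (x ^+ 2 + y ^+ 2)) * psum a r.
Proof.
move=> r1 a.
pose p k := Num.sqrt k%:R * (hermite1 k x * hermite1 k.-1 y).
pose q k := Num.sqrt k%:R * (hermite1 k.-1 x * hermite1 k y).
(* Multiplying the recurrences at x and at y produces [b] from the two trailing terms. Its
   generating function contains r^2 A', which gives one factor 1 - r^2; solving the linear system
   for P and Q gives the other. *)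
pose b k := k%:R * a k.-1.
have sx := subexponential_hermite1 x; have sy := subexponential_hermite1 y.
have sa : subexponential a by exact: subexponentialM.
have sp : subexponential p.
  apply: subexponentialM; first exact: subexponential_sqrt.
  by apply: subexponentialM => //; exact: subexponential_pred sy.
have sq : subexponential q.
  apply: subexponentialM; first exact: subexponential_sqrt.
  by apply: subexponentialM => //; exact: subexponential_pred sx.
have sb : subexponential b.
  apply: subexponentialM; first exact: subexponential_nat.
  exact: subexponential_pred sa.
have sna : subexponential (fun k => k%:R * a k).
  by apply: subexponentialM => //; exact: subexponential_nat.
have P : psum p r = r * (x * psum a r - psum q r).
  rewrite psum_shift// {1}/p sqrtr0 mul0r add0r.
  rewrite (_ : (fun k => _) = (fun k => x * a k + (-1) * q k)); last first.
    by apply/funext => k; rewrite /p mulrA hermite1_rec /q /a /=; ring.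
  by rewrite psumD ?psumZ//; [ring|exact: subexponentialZ..].
have Q : psum q r = r * (y * psum a r - psum p r).
  rewrite psum_shift// {1}/q sqrtr0 mul0r add0r.
  rewrite (_ : (fun k => _) = (fun k => y * a k + (-1) * p k)); last first.
    by apply/funext => k; rewrite /q mulrCA hermite1_rec /p /a /=; ring.
  by rewrite psumD ?psumZ//; [ring|exact: subexponentialZ..].
have B : psum b r = r * (r * psum (pseries_diffs a) r + psum a r).
  rewrite psum_shift// {1}/b mul0r add0r.
  rewrite (_ : (fun k => _) = (fun k => k%:R * a k + a k)); last first.
    by apply/funext => k; rewrite /b /= -natr1; ring.
  by rewrite psumD// psum_shift// mul0r add0r.
have A' : psum (pseries_diffs a) r =
    x * y * psum a r + (- x) * psum p r + ((- y) * psum q r + psum b r).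
  rewrite -!psumZ// -!psumD//; do ?[exact: subexponentialD|exact: subexponentialZ
    |apply: subexponentialD => //].
  congr (psum _ r); apply/funext => k; rewrite /pseries_diffs /a.
  have E n : n%:R = Num.sqrt n%:R * Num.sqrt n%:R :> R.
    by rewrite -expr2 sqr_sqrtr.
  transitivity ((Num.sqrt k.+1%:R * hermite1 k.+1 x) *
      (Num.sqrt k.+1%:R * hermite1 k.+1 y)); first by rewrite [RHS]mulrACA; congr (_ * _); exact: E.
  rewrite !hermite1_rec /p /q /b /a [in k%:R * _]E /=.
  by move: (Num.sqrt _) (hermite1 _ _) (hermite1 _ _) => *; ring.
set A := psum a r in P Q B A' *; set D := psum (pseries_diffs a) r in B A' *.
rewrite B in A'.
have P' : (1 - r ^+ 2) * psum p r = r * (x - r * y) * A.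
  rewrite mulrBl mul1r {1}P Q; ring.
have Q' : (1 - r ^+ 2) * psum q r = r * (y - r * x) * A.
  rewrite mulrBl mul1r {1}Q P; ring.
have D' : (1 - r ^+ 2) * D = x * y * A + r * A - x * psum p r - y * psum q r.
  by rewrite mulrBl mul1r {1}A'; ring.
rewrite expr2 -mulrA D'.
transitivity ((1 - r ^+ 2) * (x * y * A + r * A)
  - x * ((1 - r ^+ 2) * psum p r) - y * ((1 - r ^+ 2) * psum q r)); first by ring.
by rewrite P' Q'; ring.
Qed.

Lemma mehler_gt0 r x y : `|r| < 1 -> 0 < mehler r x y.
Proof.
move=> r1; rewrite mulr_gt0 ?expR_gt0// invr_gt0 sqrtr_gt0 subr_gt0.
by rewrite -real_normK ?num_real// expr_lt1.
Qed.

(** The quotient W of the generating function by the Mehler kernel has zero derivative, because both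
    solve the same linear equation; W 0 = 1, and the mean value theorem carries this to r. *)
Theorem psum_hermite_mehler x y r : 0 <= r < 1 ->
  psum (fun k => hermite1 k x * hermite1 k y) r = mehler r x y.
Proof.
move=> /andP[r0 r1].
set a := fun k => _; pose A : R -> R := psum a.
have sa : subexponential a by apply: subexponentialM; exact: subexponential_hermite1.
pose e s : R := - ((2 * s * x * y - s ^+ 2 * (x ^+ 2 + y ^+ 2)) / (2 * (1 - s ^+ 2))).
pose W (s : R) : R := A s * (Num.sqrt (1 - s ^+ 2) * expR (e s)).
have W' (s : R) : `|s| < 1 -> is_derive s (1 : R) W 0.
  move=> s1.
  have d0 : 0 < 1 - s ^+ 2 by rewrite subr_gt0 -real_normK ?num_real// expr_lt1.
  have DA : is_derive s (1 : R) A (psum (pseries_diffs a) s) by exact: is_derive_psum.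
  have DQ : is_derive s (1 : R) (fun s : R => 1 - s ^+ 2) (- (2 * s)).
    by apply: is_derive_eq; rewrite /GRing.scale/=; ring.
  have DS : is_derive s (1 : R) (fun s : R => Num.sqrt (1 - s ^+ 2))
      ((2 * Num.sqrt (1 - s ^+ 2))^-1 * (- (2 * s))).
    exact: (@is_derive1_comp _ Num.sqrt (fun s : R => 1 - s ^+ 2) s _ _ (is_derive1_sqrt d0) DQ).
  have DE : is_derive s (1 : R) e (- ((x * y - s * (x ^+ 2 + y ^+ 2)) / (1 - s ^+ 2)
    + s * (2 * s * x * y - s ^+ 2 * (x ^+ 2 + y ^+ 2)) / (1 - s ^+ 2) ^+ 2)).
    have DI : is_derive s (1 : R) (fun s : R => (2 * (1 - s ^+ 2))^-1)
        (s / (1 - s ^+ 2) ^+ 2).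
      have n0 : 2 * (1 - s ^+ 2) != 0 by rewrite gt_eqF// mulr_gt0.
      by apply: is_derive_eq; rewrite /GRing.scale/=; field; rewrite gt_eqF.
    by rewrite /e; apply: is_derive_eq; rewrite /GRing.scale/=; field; rewrite gt_eqF.
  have DX : is_derive s (1 : R) (fun s : R => expR (e s))
    (expR (e s) * (- ((x * y - s * (x ^+ 2 + y ^+ 2)) / (1 - s ^+ 2)
    + s * (2 * s * x * y - s ^+ 2 * (x ^+ 2 + y ^+ 2)) / (1 - s ^+ 2) ^+ 2))).
    exact: (@is_derive1_comp _ expR e).
  rewrite /W; apply: is_derive_eq; rewrite /GRing.scale /=.
  have := mehler_ode x y s1; rewrite /= -/a -/(A s) => ode.
  have {ode}-> : psum (pseries_diffs a) s = (s * (1 - s ^+ 2) + x * y * (1 + s ^+ 2) -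
       s * (x ^+ 2 + y ^+ 2)) * A s / (1 - s ^+ 2) ^+ 2.
    by rewrite -ode; field; rewrite gt_eqF.
  have q0 : Num.sqrt (1 - s ^+ 2) != 0 by rewrite gt_eqF// sqrtr_gt0.
  have qE : (1 - s ^+ 2) = Num.sqrt (1 - s ^+ 2) ^+ 2 by rewrite sqr_sqrtr// ltW.
  have d1 : 1 - s ^+ 2 != 0 by rewrite gt_eqF.
  move: (Num.sqrt _) (A s) (expR _) q0 qE => q As E q0 qE.
  (* Multiplying by q leaves only q^2, so that replacing it by 1 - s^2 reduces the claim to a
     rational identity. *)
  apply: (mulIf q0); rewrite mul0r.
  transitivity
    (E * As * (q ^+ 2 * ((s * (1 - s ^+ 2) + x * y * (1 + s ^+ 2) -
       s * (x ^+ 2 + y ^+ 2)) / (1 - s ^+ 2) ^+ 2) - s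
     + q ^+ 2 * (- ((x * y - s * (x ^+ 2 + y ^+ 2)) / (1 - s ^+ 2)
    + s * (2 * s * x * y - s ^+ 2 * (x ^+ 2 + y ^+ 2)) / (1 - s ^+ 2) ^+ 2)))).
    by field; rewrite q0 d1.
  by rewrite -qE; field.
have W0 : W 0 = 1.
  rewrite /W /A psum_shift ?normr0// mul0r addr0 /a !hermite1_0 /e.
  by rewrite expr0n/= !(mulr0, mul0r, subr0) sqrtr1 oppr0 expR0 !mulr1.
have {W0}Wr : W r = 1.
  rewrite -W0; apply/eqP; rewrite -subr_eq0; apply/eqP.
  have [||_ _] := @MVT_segment _ W (fun=> 0) 0 r r0.
  - move=> s; rewrite in_itv/= => /andP[s0 sr]; apply: W'.
    by rewrite ger0_norm ?ltW// (lt_trans sr).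
  - apply: continuous_in_subspaceT => s; rewrite inE/= in_itv/= => /andP[s0 sr].
    have s1 : `|s| < 1 by rewrite ger0_norm// (le_lt_trans sr).
    have := W' s s1 => -[dW _].
    exact/differentiable_continuous/derivable1_diffP.
  - by rewrite mul0r.
have q0 : Num.sqrt (1 - r ^+ 2) != 0.
  by rewrite gt_eqF// sqrtr_gt0 subr_gt0 expr_lt1.
have E0 : expR (e r) != 0 by rewrite gt_eqF// expR_gt0.
have -> : psum a r = (Num.sqrt (1 - r ^+ 2) * expR (e r))^-1.
  by rewrite -[RHS]mul1r; apply: (canRL (mulfK _)) => //; exact: mulf_neq0.
by rewrite invfM -expRN opprK.
Qed.

End mehler.

(** * Integration against the Gaussian density on the line *)

Lemma le_integrable_EFin d (T : measurableType d) (R : realType)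
    (mu : {measure set T -> \bar R}) (f g : T -> R) :
  measurable_fun setT f -> (forall x, `|f x| <= g x) ->
  mu.-integrable setT (EFin \o g) -> mu.-integrable setT (EFin \o f).
Proof.
move=> mf fg ig; apply: le_integrable ig => //; first exact/measurable_EFinP.
by move=> x _ /=; rewrite lee_fin (le_trans (fg x))// ler_norm.
Qed.

Lemma integrableZ_EFin d (T : measurableType d) (R : realType)
    (mu : {measure set T -> \bar R}) (c : R) (f : T -> R) :
  mu.-integrable setT (EFin \o f) ->
  mu.-integrable setT (EFin \o (fun x => c * f x)).
Proof. by move=> /(integrableZl measurableT c); under eq_fun do rewrite -EFinM. Qed.

Section gauss1.
Context {R : realType}.
Local Notation mu := (@lebesgue_measure R).
Implicit Types (p : {poly R}).

Definition gauss1 (x : R) : R :=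
  (2 * pi) `^ (- 2^-1) * expR (- x ^+ 2 / 2).

Lemma gauss1_ge0 x : 0 <= gauss1 x.
Proof. by rewrite mulr_ge0 ?powR_ge0 ?expR_ge0. Qed.

Lemma gauss1E x : gauss1 x = normal_pdf 0 1 x.
Proof.
rewrite normal_pdfE ?oner_eq0// /gauss1 /normal_fun /normal_peak subr0 expr1n mul1r.
by rewrite powRN powR12_sqrt ?mulr_ge0 ?pi_ge0// mulr_natl.
Qed.

Lemma integral_gauss1 : \int[mu]_x gauss1 x = 1.
Proof.
by rewrite /Rintegral; under eq_integral do rewrite gauss1E; rewrite integral_normal_pdf.
Qed.

Lemma integrable_expR_sqr (c : R) : 0 < c ->
  mu.-integrable setT (EFin \o (fun x => expR (- c * x ^+ 2))).
Proof.
(* The standard deviation for which the normal density has exponent - c x^2. *)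
move=> c0; pose s := Num.sqrt (2 * c)^-1.
have s0 : s != 0 by rewrite gt_eqF// sqrtr_gt0 invr_gt0 mulr_gt0.
have := integrableZ_EFin (normal_peak s)^-1 (integrable_normal_pdf 0 s).
apply: eq_integrable => // x _ /=; rewrite normal_pdfE// /normal_fun.
rewrite mulKf ?gt_eqF ?normal_peak_gt0// subr0 sqr_sqrtr ?invr_ge0 ?mulr_ge0// ?ltW//.
by congr (expR _)%:E; rewrite -mulr_natr; field; rewrite gt_eqF.
Qed.

(** Induction along Horner's scheme: half of c is spent on the shorter polynomial, half on the
    factor x, through |x| <= 1 + x^2 and 1 + z <= exp z. *)
Lemma poly_le_expR_sqr p (c : R) : 0 < c ->
  exists C, forall x, `|p.[x]| <= C * expR (c * x ^+ 2).
Proof.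
elim/poly_ind: p c => [|p a IH] c c0.
  by exists 0 => x; rewrite horner0 normr0 mul0r.
have c2 : 0 < c / 2 by rewrite divr_gt0.
have [C HC] := IH _ c2; have C0 : 0 <= C.
  by have := HC 0; rewrite expr0n/= mulr0 expR0 mulr1; apply: le_trans.
exists (C * (1 + 2 / c) + `|a|) => x.
rewrite hornerD hornerMX hornerC (le_trans (ler_normD _ _))// mulrDl lerD//; last first.
  by rewrite ler_peMr// -[leLHS]expR0 ler_expR mulr_ge0 ?sqr_ge0// ltW.
have -> : c * x ^+ 2 = c / 2 * x ^+ 2 + c / 2 * x ^+ 2 by field.
have H : `|x| <= (1 + 2 / c) * expR (c / 2 * x ^+ 2).
  have x2 : `|x| <= 1 + x ^+ 2.
    by rewrite -[x ^+ 2]real_normK ?num_real//; move: `|x| => z; nra.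
  rewrite (le_trans x2)// (@le_trans _ _ ((1 + 2 / c) * (1 + c / 2 * x ^+ 2)))//.
    have -> : (1 + 2 / c) * (1 + c / 2 * x ^+ 2) = 1 + x ^+ 2 + (2 / c + c / 2 * x ^+ 2).
      by field; rewrite gt_eqF.
    have c1 := ltW c0; have c3 := ltW c2.
    by rewrite lerDl; apply: addr_ge0; [exact: divr_ge0|rewrite mulr_ge0 ?sqr_ge0].
  by rewrite ler_wpM2l ?expR_ge1Dx// addr_ge0// divr_ge0// ltW.
rewrite expRD normrM mulrAC.
rewrite (_ : C * _ * _ = (C * expR (c / 2 * x ^+ 2)) * ((1 + 2 / c) * expR (c / 2 * x ^+ 2))).
  by apply: ler_pM => //; exact: HC.
by ring.
Qed.

Lemma measurable_gauss1 : measurable_fun setT gauss1.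
Proof.
rewrite (_ : gauss1 = normal_pdf 0 1); last by apply/funext => x; rewrite gauss1E.
exact: measurable_normal_pdf.
Qed.

Lemma measurable_horner p : measurable_fun setT (horner p).
Proof. by apply: continuous_measurable_fun; exact: continuous_horner. Qed.

Lemma poly_gauss1_le p : exists C, forall x,
  `|p.[x] * gauss1 x| <= C * expR (- 4^-1 * x ^+ 2).
Proof.
(* Half of the Gaussian exponent 1/2 absorbs the polynomial; the other half remains as decay. *)
have [C HC] := @poly_le_expR_sqr p 4^-1 ltac:(by rewrite invr_gt0).
exists (C * (2 * pi) `^ (- 2^-1)) => x.
rewrite normrM (ger0_norm (gauss1_ge0 x)) /gauss1 mulrCA.
rewrite (le_trans (ler_wpM2l _ (ler_wpM2r _ (HC x))))// ?powR_ge0 ?expR_ge0//.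
rewrite -(mulrA C (expR _)) -expRD mulrCA mulrA ler_wpM2l//.
  rewrite mulr_ge0 ?powR_ge0//.
  by have := HC 0; rewrite expr0n/= mulr0 expR0 mulr1; apply: le_trans.
by rewrite ler_expR; lra.
Qed.

Lemma integrable_poly_gauss1 p :
  mu.-integrable setT (EFin \o (fun x => p.[x] * gauss1 x)).
Proof.
have [C HC] := poly_gauss1_le p; refine (@le_integrable_EFin _ _ _ mu _ _ _ HC _).
  by apply: measurable_funM; [exact: measurable_horner|exact: measurable_gauss1].
apply/integrableZ_EFin/integrable_expR_sqr; by rewrite invr_gt0.
Qed.

Lemma cvg_poly_gauss1 p : p.[n%:R] * gauss1 n%:R @[n --> \oo] --> (0 : R).
Proof.
have [C HC] := poly_gauss1_le p.
have C0 : 0 <= C.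
  by have := HC 0; rewrite expr0n/= mulr0 expR0 mulr1; apply: le_trans.
apply/cvgr0Pnorm_lt => e e0; near=> n.
have n0 : 0 < n%:R :> R by rewrite ltr0n; near: n; exact: nbhs_infty_gt.
have n1 : 1 <= n%:R :> R by rewrite ler1n -(ltr0n R).
have ne : 4 * (C + 1) / e < n%:R by near: n; exact: nbhs_infty_gtr.
rewrite (le_lt_trans (HC _))// mulNr expRN.
rewrite ltr_pdivrMr ?expR_gt0//.
rewrite ltr_pdivrMr// in ne.
have := expR_ge1Dx (4^-1 * n%:R ^+ 2 : R); move: (expR _) => E HE.
have : 4^-1 * n%:R <= 4^-1 * n%:R ^+ 2 :> R by rewrite ler_wpM2l// expr2 ler_peMr// ltW.
move: ne HE; move: (n%:R ^+ 2) => n2 ne HE Hn.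
have : e * (4^-1 * n%:R) <= e * E by rewrite ler_pM2l//; lra.
move: ne; lra.
Unshelve. all: by end_near. Qed.

(** The integrand is the derivative of [p] times the density, whose boundary values vanish at
    infinity. This is the integration by parts behind all Hermite moments below. *)
Lemma Rintegral_deriv_gauss1 p :
  \int[mu]_x ((p^`() - 'X * p).[x] * gauss1 x) = 0.
Proof.
pose F x := p.[x] * gauss1 x; pose f x := (p^`() - 'X * p).[x] * gauss1 x.
have dF x : is_derive x (1 : R) F (f x).
  have D := is_derive_gauss x.
  have D' : is_derive x (1 : R) gauss1 ((2 * pi) `^ (- 2^-1) * (- x * expR (- x ^+ 2 / 2))).
    by rewrite /gauss1; apply: is_derive_eq; rewrite /GRing.scale/=; field.
  rewrite /F; apply: is_derive_eq; rewrite /f /GRing.scale/=.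
  rewrite hornerD hornerN hornerM hornerX /gauss1.
  by move: (expR _) (_ `^ _) => *; ring.
(* The bounds use n + 1 so that the interval is never reduced to a point. *)
have fE n : (\int[mu]_(x in `[(- n.+1%:R)%R, n.+1%:R%R]) (f x)%:E =
    (F n.+1%:R - F (- n.+1%:R))%:E)%E.
  rewrite (@continuous_FTC2 _ f F) ?EFinB//.
  - by rewrite gtrN.
  - apply: continuous_subspaceT => x; apply: continuousM; first exact: continuous_horner.
    have D := is_derive_gauss x.
    apply: continuousM; first exact: cst_continuous.
    by apply/differentiable_continuous/derivable1_diffP; case: D.
  - have cF : continuous F.
      by move=> x; apply/differentiable_continuous/derivable1_diffP; case: (dF x).
    split; first by move=> x _; case: (dF x).
    + by apply: cvg_at_right_filter; exact: cF.
    + by apply: cvg_at_left_filter; exact: cF.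
  - by move=> x _; rewrite derive1E; case: (dF x).
have iF : mu.-integrable setT (EFin \o f) by exact: integrable_poly_gauss1.
pose I (n : nat) := [set` `[- n.+1%:R, n.+1%:R : R]].
have := @dominated_convergence _ _ R mu setT measurableT
  (fun n => (EFin \o f) \_ (I n)) (EFin \o f) (abse \o (EFin \o f)).
case.
- move=> n; have mI : measurable (I n : set (measurableTypeR R)) by exact: measurable_itv.
  apply/(measurable_restrictT _ mI).
  by apply: measurable_funTS; case/integrableP: iF.
- by case/integrableP: iF.
- apply/aeW => x _; apply: cvg_near_cst; near=> n.
  rewrite patchE mem_set// /I /= in_itv/=.
  rewrite -ler_norml (@le_trans _ _ n%:R) ?ler_nat//.
  by near: n; exact: nbhs_infty_ger.
- exact: integrable_abse.
- by apply/aeW => x n _; rewrite patchE; case: ifP => _; rewrite ?abse0 ?abse_ge0 ?lexx.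
move=> _ _ H.
have {}H : (F n.+1%:R - F (- n.+1%:R))%:E @[n --> \oo] --> (\int[mu]_x (f x)%:E)%E.
  apply: cvg_trans H; rewrite (_ : (fun n => _) =
    [sequence (\int[mu]_x ((EFin \o f) \_ (I n)) x)%E]_n)//.
  by apply/funext => n /=; rewrite -fE /I integral_mkcond.
have F0 : (F n.+1%:R - F (- n.+1%:R)) @[n --> \oo] --> (0 : R).
  rewrite -[0 in X in _ --> X]subr0; apply: cvgB.
    by move: (cvg_poly_gauss1 p); rewrite -(cvg_shiftS).
  move: (cvg_poly_gauss1 (p \Po (- 'X))); rewrite -cvg_shiftS.
  apply: cvg_trans; apply: near_eq_cvg; apply: nearW => n.
  by rewrite /F /= horner_comp hornerN hornerX /gauss1 sqrrN.
have E0 : (F n.+1%:R - F (- n.+1%:R))%:E @[n --> \oo] --> 0%:E.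
  by apply: cvg_EFin; [exact: nearW|exact: F0].
by rewrite /Rintegral (cvg_unique _ H E0).
Unshelve. all: by end_near. Qed.

Lemma RintegralN_poly_gauss1 p : \int[mu]_x ((- p).[x] * gauss1 x) =
  - \int[mu]_x (p.[x] * gauss1 x).
Proof.
rewrite -[RHS]mulN1r -RintegralZl//; last exact: integrable_poly_gauss1.
by apply: eq_Rintegral => x _; rewrite hornerN mulNr mulN1r.
Qed.

Lemma RintegralB_poly_gauss1 p q : \int[mu]_x ((p - q).[x] * gauss1 x) =
  \int[mu]_x (p.[x] * gauss1 x) - \int[mu]_x (q.[x] * gauss1 x).
Proof.
rewrite -RintegralB//; [|exact: integrable_poly_gauss1..].
by apply: eq_Rintegral => x _; rewrite hornerD hornerN mulrBl.
Qed.

Lemma Rintegral_hpoly k : \int[mu]_x ((hpoly k).[x] * gauss1 x) = (k == 0%N)%:R.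
Proof.
case: k => [|k].
  rewrite -[RHS]integral_gauss1; apply: eq_Rintegral => x _.
  by rewrite hornerC mul1r.
apply: oppr_inj; rewrite -RintegralN_poly_gauss1 /= opprB oppr0.
exact: Rintegral_deriv_gauss1.
Qed.

(** With p = He_k and q = He_(k+1) = X p - p', the polynomial q^2 equals q' p up to a term of
    integral zero, and q' = (k + 1) p. *)
Lemma Rintegral_hpoly_sqr k :
  \int[mu]_x ((hpoly k * hpoly k).[x] * gauss1 x) = k`!%:R.
Proof.
elim: k => [|k IH].
  rewrite -[RHS]integral_gauss1; apply: eq_Rintegral => x _.
  by rewrite mulr1 hornerC mul1r.
have E (p q : {poly R}) : q = 'X * p - deriv p ->
    q * q = deriv q * p - (deriv (q * p) - 'X * (q * p)).
  by move=> qE; rewrite derivM {2}qE; ring.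
rewrite (E (hpoly k) (hpoly k.+1) erefl) RintegralB_poly_gauss1 Rintegral_deriv_gauss1.
rewrite subr0 deriv_hpolyS.
rewrite factS natrM -IH -RintegralZl//; last exact: integrable_poly_gauss1.
by apply: eq_Rintegral => x _; rewrite mulrnAl hornerMn -mulr_natl -mulrA.
Qed.

Lemma hermite1_sqrE k (x : R) :
  hermite1 k x ^+ 2 = ((k`!%:R : R)^-1 *: (hpoly k * hpoly k)).[x].
Proof.
rewrite hornerZ hornerM hermite1E exprMn exprVn sqr_sqrtr//.
by rewrite mulrC expr2.
Qed.

Lemma integrable_hermite1 k :
  mu.-integrable setT (EFin \o (fun x => hermite1 k x * gauss1 x)).
Proof.
have := integrable_poly_gauss1 ((Num.sqrt k`!%:R)^-1 *: hpoly k).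
by apply: eq_integrable => // x _ /=; rewrite hornerZ hermite1E (mulrC (_^-1)).
Qed.

Lemma integrable_hermite1_sqr k :
  mu.-integrable setT (EFin \o (fun x => hermite1 k x ^+ 2 * gauss1 x)).
Proof.
have := integrable_poly_gauss1 (k`!%:R^-1 *: (hpoly k * hpoly k)).
by apply: eq_integrable => // x _ /=; rewrite hermite1_sqrE.
Qed.

Lemma Rintegral_hermite1 k :
  \int[mu]_x (hermite1 k x * gauss1 x) = (k == 0%N)%:R.
Proof.
transitivity ((Num.sqrt k`!%:R)^-1 * \int[mu]_x ((hpoly k).[x] * gauss1 x)).
  rewrite -RintegralZl//; last exact: integrable_poly_gauss1.
  by apply: eq_Rintegral => x _; rewrite hermite1E mulrAC mulrC.
by rewrite Rintegral_hpoly; case: k => [|k]; rewrite ?mulr0// sqrtr1 invr1 mul1r.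
Qed.

Lemma Rintegral_hermite1_sqr k :
  \int[mu]_x (hermite1 k x ^+ 2 * gauss1 x) = 1.
Proof.
transitivity (k`!%:R^-1 * \int[mu]_x ((hpoly k * hpoly k).[x] * gauss1 x)).
  rewrite -RintegralZl//; last exact: integrable_poly_gauss1.
  by apply: eq_Rintegral => x _; rewrite hermite1_sqrE hornerZ -mulrA.
by rewrite Rintegral_hpoly_sqr mulVf// pnatr_eq0 -lt0n fact_gt0.
Qed.

(** On the diagonal the kernel grows like exp (y^2 r / (1 + r)), and r / (1 + r) < 1/2, so the
    Gaussian wins. The diagonal will serve to dominate the partial sums of the kernel. *)
Lemma integrable_mehler_diag (r : R) : 0 <= r < 1 ->
  mu.-integrable setT (EFin \o (fun y => mehler r y y * gauss1 y)).
Proof.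
move=> /andP[r0 r1].
pose c : R := (1 - r) / (2 * (1 + r)).
have c0 : 0 < c by rewrite divr_gt0 ?mulr_gt0 ?subr_gt0// ltr_wpDr.
have := integrableZ_EFin ((Num.sqrt (1 - r ^+ 2))^-1 * (2 * pi) `^ (- 2^-1))
  (integrable_expR_sqr c0).
apply: eq_integrable => // y _ /=; rewrite /mehler /gauss1 mulrACA -expRD.
have a1 : 1 + r != 0 by rewrite gt_eqF// ltr_wpDr.
have a2 : 1 - r ^+ 2 != 0 by rewrite gt_eqF// subr_gt0 expr_lt1.
by congr (_ * expR _)%:E; rewrite /c; field; rewrite ?a1 ?a2.
Qed.

End gauss1.

(** * Integrals of tensor products *)

Section product_integral.
Context d1 d2 (T1 : measurableType d1) (T2 : measurableType d2) (R : realType).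
Variables (m1 : {sigma_finite_measure set T1 -> \bar R})
          (m2 : {sigma_finite_measure set T2 -> \bar R}).
Variables (f : T1 -> R) (g : T2 -> R).
Hypotheses (fi : m1.-integrable setT (EFin \o f))
           (gi : m2.-integrable setT (EFin \o g)).

Lemma integrable_prod_fun :
  (m1 \x m2)%E.-integrable setT (EFin \o (fun z => f z.1 * g z.2)).
Proof.
have mf : measurable_fun setT f by apply/measurable_EFinP; case/integrableP: fi.
have mg : measurable_fun setT g by apply/measurable_EFinP; case/integrableP: gi.
have mfg : measurable_fun setT (EFin \o (fun z : T1 * T2 => f z.1 * g z.2)).
  by apply/measurable_EFinP; apply: measurable_funM; exact: measurableT_comp.
apply/integrable12ltyP => //=.
have -> : (fun x => \int[m2]_y `|(f x * g y)%:E|)%E =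
    (fun x => `|(f x)%:E| * \int[m2]_y `|(g y)%:E|)%E.
  apply/funext => x; rewrite -ge0_integralZl//.
  - by apply: eq_integral => y _; rewrite EFinM abseM.
  - by do 2 apply: measurableT_comp => //.
have gf : (\int[m2]_y `|(g y)%:E|)%E \is a fin_num.
  exact: (integrable_fin_num measurableT (integrable_abse gi)).
rewrite -(fineK gf) ge0_integralZr//; last 2 first.
- by do 2 apply: measurableT_comp => //.
- by rewrite lee_fin fine_ge0// integral_ge0.
apply: lte_mul_pinfty; [exact: integral_ge0| |by rewrite ltry].
exact: (integrable_fin_num measurableT (integrable_abse fi)).
Qed.

Lemma Rintegral_prod_fun :
  \int[(m1 \x m2)%E]_z (f z.1 * g z.2) = (\int[m1]_x f x) * \int[m2]_y g y.
Proof.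
rewrite /Rintegral -integral12_prod_meas1/=; last exact: integrable_prod_fun.
rewrite /fubini_F/=.
have gf : (\int[m2]_y (g y)%:E)%E \is a fin_num.
  exact: (integrable_fin_num measurableT gi).
have -> : (fun x => \int[m2]_y (f x * g y)%:E)%E =
    (fun x => (f x)%:E * (fine (\int[m2]_y (g y)%:E))%:E)%E.
  apply/funext => x; rewrite fineK// -integralZl//.
rewrite integralZr// fineM//; exact: (integrable_fin_num measurableT fi).
Qed.

End product_integral.

(** * The Gaussian measure on R^d *)

Section tuple_integral.
Context {R : realType}.
Local Notation mu := (@lebesgue_measure R).
Local Notation T := (measurableTypeR R).

(** Integrability and value are proved together, since the Fubini step for the value uses the
    integrability of the remaining coordinates. *)
Lemma integral_tuple_prod d (g : 'I_d -> R -> R) :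
  (forall i, mu.-integrable setT (EFin \o g i)) ->
  (lebesgue_tuple R d).-integrable setT
    (EFin \o (fun t => \prod_(i < d) g i (tnth t i))) /\
  \int[lebesgue_tuple R d]_t \prod_(i < d) g i (tnth t i) =
    \prod_(i < d) \int[mu]_x g i x.
Proof.
elim: d g => [|d IH] g gi.
  split.
    have -> : EFin \o (fun t : 0.-tuple T => \prod_(i < 0) g i (tnth t i)) = cst 1%E.
      by apply/funext => t /=; rewrite big_ord0.
    apply/integrableP; split => //.
    by rewrite integral_dirac//= diracT mul1e normr1 ltry.
  rewrite /Rintegral integral_dirac//; last first.
    by apply/measurable_EFinP; apply: measurable_prod => -[].
  by rewrite diracT mul1e !big_ord0.
pose cons_pair (p : T * d.-tuple T) : d.+1.-tuple T := [tuple of p.1 :: p.2].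
have mcons : measurable_fun setT cons_pair by exact: measurable_cons.
have [IH1 IH2] := IH (fun i => g (lift ord0 i)) (fun i => gi (lift ord0 i)).
pose F := EFin \o (fun t : d.+1.-tuple T => \prod_(i < d.+1) g i (tnth t i)).
have FE : F \o cons_pair = EFin \o (fun z : T * d.-tuple T =>
    g ord0 z.1 * \prod_(i < d) g (lift ord0 i) (tnth z.2 i)).
  apply/funext => z; rewrite /F /= big_ord_recl; congr (_ * _)%:E.
  by apply: eq_bigr => i _; rewrite tnthS.
have mF : measurable_fun setT F.
  apply/measurable_EFinP; apply: measurable_prod => i _.
  apply: (measurableT_comp (f := g i)); last exact: measurable_tnth.
  by apply/measurable_EFinP; case/integrableP: (gi i).
have iF : (lebesgue_measure \x lebesgue_tuple R d)%E.-integrable setT (F \o cons_pair).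
  by rewrite FE; exact: (integrable_prod_fun (gi ord0) IH1).
split; first exact: (integrable_pushforward mcons mF iF measurableT).
rewrite big_ord_recl -IH2 -(Rintegral_prod_fun (gi ord0) IH1) /Rintegral.
rewrite (_ : (\int[lebesgue_tuple R d.+1]_t (\prod_(i < d.+1) g i (tnth t i))%:E)%E =
   (\int[lebesgue_measure \x lebesgue_tuple R d]_z (F \o cons_pair) z)%E).
  by rewrite FE.
exact: (integral_pushforward mcons mF iF measurableT).
Qed.

(** Topology lives on rows and measurability on tuples, so the two are linked by hand: f is the
    pointwise limit of its values at the lower corners of a grid of mesh 1/(m+1). Each approximation
    factors through integer tuples, hence takes countably many values. *)
Lemma continuous_measurable_row d (f : 'rV[R]_d -> R) : continuous f ->
  measurable_fun setT (f \o @row_of_tuple R d).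
Proof.
move=> cf.
pose Z (m : nat) (t : d.-tuple T) : d.-tuple int :=
  [tuple Num.floor (m.+1%:R * tnth t i) | i < d].
pose F (m : nat) (z : d.-tuple int) := f (\row_i ((tnth z i)%:~R / m.+1%:R)).
apply: (@measurable_fun_cvg _ _ _ _ (fun m t => F m (Z m t))) => [m _ Y mY|t _].
  rewrite setTI.
  (* Integer tuples are enumerated by their codes, which makes the preimage a countable union of
     grid cells. *)
  have -> : (fun t => F m (Z m t)) @^-1` Y = \bigcup_(n in [set n |
      oapp (fun z => Y (F m z)) False (@pickle_inv (d.-tuple int) n)])
      [set t | pickle_inv n = Some (Z m t)].
    apply/seteqP; split => [t /= Yt|t [n /= + tn]]; last by rewrite tn.
    by exists (pickle (Z m t)); rewrite /= pickleK_inv.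
  apply: bigcup_measurable => n /=; case: (pickle_inv n) => [z|//] _.
  have -> : [set t | Some z = Some (Z m t)] = \bigcap_(i in [set: 'I_d])
      ((@tnth d T ^~ i) @^-1` [set x : T | Num.floor (m.+1%:R * x) == tnth z i]).
    apply/seteqP; split => [t /= [->] i _ /=|t /= tn].
      by rewrite tnth_mktuple.
    congr Some; apply: eq_from_tnth => i; rewrite tnth_mktuple.
    by apply/esym/eqP; exact: tn.
  apply: fin_bigcap_measurable => // i _.
  rewrite -[X in measurable X]setTI; apply: measurable_tnth => //.
  have -> : [set x : T | Num.floor (m.+1%:R * x) == tnth z i] =
      `[(tnth z i)%:~R / m.+1%:R, (tnth z i + 1)%:~R / m.+1%:R[%classic.
    apply/seteqP; split => x /=; rewrite in_itv/= floor_eq;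
      by rewrite ler_pdivrMr// ltr_pdivlMr// (mulrC x).
  exact: measurable_itv.
apply: (continuous_cvg _ (cf (row_of_tuple t))).
apply/cvg_ballP => e e0; near=> m.
split=> // i j; rewrite !mxE tnth_mktuple -ball_normE /ball_/=.
have N0 : 0 < m.+1%:R :> R by rewrite ltr0n.
have me : m.+1%:R^-1 < e by near: m; exact: near_infty_natSinv_lt (PosNum e0).
move: (tnth t j) => x.
have /andP[l u] : (Num.floor (m.+1%:R * x))%:~R <= m.+1%:R * x <
    (Num.floor (m.+1%:R * x) + 1)%:~R by rewrite -floor_eq.
rewrite (le_lt_trans _ me)// ger0_norm.
  rewrite lerBlDr -{1}[_^-1]mul1r -mulrDl ler_pdivlMr//.
  by move: u; rewrite intrD => /ltW; rewrite (mulrC x) addrC.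
by rewrite subr_ge0 ler_pdivrMr// (mulrC x).
Unshelve. all: by end_near. Qed.

Lemma gauss_density_tuple d (t : d.-tuple T) :
  gauss_density (row_of_tuple t) = \prod_(i < d) gauss1 (tnth t i).
Proof.
rewrite /gauss_density big_split/= prodr_const card_ord -expR_sum.
congr (_ * expR _).
  rewrite -powR_mulrn ?powR_ge0// -powRrM; congr (_ `^ _).
  by rewrite mulNr mulrC.
rewrite -sumrN mulr_suml; apply: eq_bigr => i _.
by rewrite mxE.
Qed.

Lemma gauss_density_ge0 d (x : 'rV[R]_d) : 0 <= gauss_density x.
Proof. by rewrite mulr_ge0 ?powR_ge0 ?expR_ge0. Qed.

Lemma measurable_gauss_density d :
  measurable_fun setT (fun t : d.-tuple T => gauss_density (row_of_tuple t)).
Proof.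
rewrite (_ : (fun t => _) = (fun t => \prod_(i < d) gauss1 (tnth t i))).
  apply: measurable_prod => i _.
  by apply: (measurableT_comp measurable_gauss1); exact: measurable_tnth.
by apply/funext => t; rewrite gauss_density_tuple.
Qed.

Lemma gauss_prod d (g : 'I_d -> R -> R) :
  (forall i, mu.-integrable setT (EFin \o (fun x => g i x * gauss1 x))) ->
  gauss_integrable (fun x : 'rV[R]_d => \prod_(i < d) g i (x 0 i)) /\
  gauss_integral (fun x : 'rV[R]_d => \prod_(i < d) g i (x 0 i)) =
    \prod_(i < d) \int[mu]_x (g i x * gauss1 x).
Proof.
move=> gi; have [H1 H2] := integral_tuple_prod gi.
have E (t : d.-tuple T) :
    (\prod_(i < d) g i (row_of_tuple t 0 i)) * gauss_density (row_of_tuple t) =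
    \prod_(i < d) (g i (tnth t i) * gauss1 (tnth t i)).
  rewrite gauss_density_tuple -big_split; apply: eq_bigr => i _.
  by rewrite mxE.
split; first by apply: eq_integrable H1 => // t _ /=; rewrite E.
by rewrite -H2; apply: eq_Rintegral => t _; rewrite E.
Qed.

Lemma hermite_ffun0 d (x : 'rV[R]_d) : hermite [ffun=> 0%N] x = 1.
Proof. by rewrite /hermite big1// => i _; rewrite ffunE hermite1_0. Qed.

Lemma gauss_hermite d (k : {ffun 'I_d -> nat}) :
  gauss_integrable (hermite k : 'rV[R]_d -> R) /\
  gauss_integral (hermite k : 'rV[R]_d -> R) = (k == [ffun=> 0%N])%:R.
Proof.
have [H1 H2] := gauss_prod (fun i => integrable_hermite1 (k i)).
split; first exact: H1.
rewrite H2; under eq_bigr do rewrite Rintegral_hermite1.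
have [->|/eqP k0] := eqVneq k; first by rewrite big1// => i _; rewrite ffunE.
have /existsP[i ki] : [exists i, k i != 0%N].
  apply: contra_notT k0 => /existsPn H; apply/ffunP => i; rewrite ffunE.
  by apply/eqP; rewrite -[_ == _]negbK H.
by rewrite (bigD1 i)//= (negbTE ki) mul0r.
Qed.

Lemma gauss_hermite_sqr d (k : {ffun 'I_d -> nat}) :
  gauss_integrable (fun x : 'rV[R]_d => hermite k x ^+ 2) /\
  gauss_integral (fun x : 'rV[R]_d => hermite k x ^+ 2) = 1.
Proof.
have [] := gauss_prod (fun i => integrable_hermite1_sqr (k i)).
have -> : (fun x : 'rV[R]_d => \prod_(i < d) hermite1 (k i) (x 0 i) ^+ 2) =
    (fun x => hermite k x ^+ 2).
  by apply/funext => x; rewrite /hermite prodrXl.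
move=> H1 H2; split; first exact: H1.
by rewrite H2 big1// => i _; rewrite Rintegral_hermite1_sqr.
Qed.

Lemma gauss_integral1 d :
  gauss_integrable (cst 1 : 'rV[R]_d -> R) /\ gauss_integral (cst 1 : 'rV[R]_d -> R) = 1.
Proof.
have [] := @gauss_hermite d [ffun=> 0%N].
by rewrite (_ : hermite _ = cst 1) ?eqxx//; apply/funext => x; rewrite hermite_ffun0.
Qed.

End tuple_integral.

(** The sum of the w (B a - C b)^2 is nonnegative and equals B (A B - C^2). Zero weights are allowed
    because the error bound removes the constant term that way. *)
Lemma cauchy_schwarz_weighted (R : realFieldType) (I : finType) (w a b : I -> R) :
  (forall i, 0 <= w i) ->
  (\sum_i w i * (a i * b i)) ^+ 2 <=
  (\sum_i w i * a i ^+ 2) * (\sum_i w i * b i ^+ 2).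
Proof.
move=> w0; set A := \sum_i w i * a i ^+ 2; set B := \sum_i w i * b i ^+ 2.
set C := \sum_i _.
have B0 : 0 <= B by apply: sumr_ge0 => i _; rewrite mulr_ge0 ?sqr_ge0.
have [B0'|Bn0] := eqVneq B 0.
  have wb i : w i * b i ^+ 2 = 0.
    by apply: (psumr_eq0P _ B0') => // j _; rewrite mulr_ge0 ?sqr_ge0.
  rewrite /C big1 ?expr0n/= ?B0' ?mulr0// => i _.
  have /eqP := wb i; rewrite mulf_eq0 expf_eq0/= => /orP[/eqP->|/eqP->].
    by rewrite mul0r.
  by rewrite !mulr0.
have {}B0 : 0 < B by rewrite lt0r Bn0.
have : 0 <= \sum_i w i * (B * a i - C * b i) ^+ 2.
  by apply: sumr_ge0 => i _; rewrite mulr_ge0 ?sqr_ge0.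
have -> : \sum_i w i * (B * a i - C * b i) ^+ 2 = B * (A * B - C ^+ 2).
  under eq_bigr => i _.
    rewrite (_ : _ * _ = B ^+ 2 * (w i * a i ^+ 2) - 2 * B * C * (w i * (a i * b i)) +
      C ^+ 2 * (w i * b i ^+ 2)); last by ring.
    over.
  by rewrite big_split /= sumrB -!mulr_sumr -/A -/B -/C; ring.
by rewrite pmulr_rge0// subr_ge0.
Qed.

Lemma cvg_prodr (R : realFieldType) (I : Type) (s : seq I) (u : I -> nat -> R) (l : I -> R) :
  (forall i, u i n @[n --> \oo] --> l i) ->
  \prod_(i <- s) u i n @[n --> \oo] --> \prod_(i <- s) l i.
Proof.
move=> ul; elim: s => [|i s IH].
  by rewrite big_nil; under eq_fun do rewrite big_nil; exact: cvg_cst.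
by rewrite big_cons; under eq_fun do rewrite big_cons; exact: cvgM.
Qed.

(** * Abel means of the Hermite expansion on R^d *)

Section mehler_expansion.
Context {R : realType} (d : nat).
Local Notation T := (measurableTypeR R).
Implicit Types (x y : 'rV[R]_d) (r : R).

Definition mehler_row r x y : R := \prod_(i < d) mehler r (x 0 i) (y 0 i).

(** Truncation to cubes, rather than by total degree, lets sums of products factor over the
    coordinates. *)
Definition box N (k : {ffun 'I_d -> 'I_N}) : {ffun 'I_d -> nat} :=
  [ffun i => nat_of_ord (k i)].

(** Used for two choices of [c]: [hermite ^~ y] gives the truncated Mehler kernel, [hermite_coef f]
    the truncated Abel mean of f. *)
Definition hermite_abel_sum r (c : {ffun 'I_d -> nat} -> R) x N : R :=
  \sum_(k : {ffun 'I_d -> 'I_N})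
    r ^+ (\sum_i box k i) * (c (box k) * hermite (box k) x).

Lemma hermite_abel_sum_prod r x y N :
  hermite_abel_sum r (fun k => hermite k y) x N =
  \prod_(i < d) pseries (fun k => hermite1 k (x 0 i) * hermite1 k (y 0 i)) r N.
Proof.
rewrite /pseries /series/=.
under eq_bigr do rewrite big_mkord.
rewrite bigA_distr_bigA/=; apply: eq_bigr => k _.
rewrite /hermite -prodrXr -!big_split/=; apply: eq_bigr => i _.
by rewrite ffunE /= mulrC (mulrC (hermite1 _ _)).
Qed.

Lemma cvg_hermite_abel_sum r x y : 0 <= r < 1 ->
  hermite_abel_sum r (fun k => hermite k y) x N @[N --> \oo] --> mehler_row r x y.
Proof.
move=> r01; under eq_fun do rewrite hermite_abel_sum_prod.
apply: cvg_prodr => i; rewrite -(psum_hermite_mehler _ _ r01).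
move: r01 => /andP[r0 r1]; apply: cvg_psum; last by rewrite ger0_norm.
by apply: subexponentialM; exact: subexponential_hermite1.
Qed.

(** Cauchy-Schwarz with weights r^k reduces to s = t, where the terms are nonnegative and partial
    sums stay below their limit. The bound is uniform in N, as dominated convergence requires. *)
Lemma pseries_hermite1_le_mehler r (s t : R) N : 0 <= r < 1 ->
  pseries (fun k => hermite1 k s * hermite1 k t) r N ^+ 2 <=
  mehler r s s * mehler r t t.
Proof.
move=> r01; have /andP[r0 r1] := r01.
have le u : \sum_(k < N) r ^+ k * hermite1 k u ^+ 2 <= mehler r u u.
  rewrite -(psum_hermite_mehler _ _ r01).
  have -> : \sum_(k < N) r ^+ k * hermite1 k u ^+ 2 =
      pseries (fun k => hermite1 k u * hermite1 k u) r N.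
    by rewrite /pseries /series/= big_mkord; apply: eq_bigr => k _; rewrite mulrC.
  apply: nondecreasing_cvgn_le.
    apply/nondecreasing_seqP => n; rewrite /pseries /series/= big_nat_recr//= lerDl.
    by rewrite mulr_ge0 ?exprn_ge0// -expr2 sqr_ge0.
  apply/cvg_ex; exists (psum (fun k => hermite1 k u * hermite1 k u) r).
  apply: cvg_psum; last by rewrite ger0_norm.
  by apply: subexponentialM; exact: subexponential_hermite1.
rewrite /pseries /series/= big_mkord.
under eq_bigr do rewrite mulrC.
have w0 (k : 'I_N) : 0 <= r ^+ k by exact: exprn_ge0.
have := cauchy_schwarz_weighted (fun k : 'I_N => hermite1 k s)
  (fun k : 'I_N => hermite1 k t) w0.
move=> /le_trans; apply.
by apply: ler_pM; rewrite ?le//; apply: sumr_ge0 => i _; rewrite mulr_ge0 ?sqr_ge0.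
Qed.

Lemma hermite_abel_sum_sqr_le r x y N : 0 <= r < 1 ->
  hermite_abel_sum r (fun k => hermite k y) x N ^+ 2 <=
  mehler_row r x x * mehler_row r y y.
Proof.
move=> r01; rewrite hermite_abel_sum_prod -prodrXl -big_split/=.
by apply: ler_prod => i _; rewrite sqr_ge0/= pseries_hermite1_le_mehler.
Qed.

Lemma mehler_row_ge0 r x y : 0 <= r < 1 -> 0 <= mehler_row r x y.
Proof.
move=> /andP[r0 r1]; apply: prodr_ge0 => i _; apply/ltW/mehler_gt0.
by rewrite ger0_norm.
Qed.

Lemma measurable_mehler_row r x :
  measurable_fun setT (fun t : d.-tuple T => mehler_row r x (row_of_tuple t)).
Proof.
apply: measurable_prod => i _.
have -> : (fun t : d.-tuple T => mehler r (x 0 i) (row_of_tuple t 0 i)) =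
    (mehler r (x 0 i)) \o (fun t : d.-tuple T => tnth t i).
  by apply/funext => t; rewrite /= mxE.
apply: measurableT_comp; last exact: measurable_tnth.
apply: continuous_measurable_fun => y.
apply/differentiable_continuous/derivable1_diffP; rewrite /mehler; exact: ex_derive.
Qed.

Lemma measurable_hermite (k : {ffun 'I_d -> nat}) :
  measurable_fun setT (fun t : d.-tuple T => hermite k (row_of_tuple t)).
Proof.
apply: measurable_prod => i _.
have -> : (fun t : d.-tuple T => hermite1 (k i) (row_of_tuple t 0 i)) =
    ((fun z => (hpoly (k i)).[z] / Num.sqrt (k i)`!%:R) \o (fun t : d.-tuple T => tnth t i)).
  by apply/funext => t; rewrite /= mxE hermite1E.
apply: measurableT_comp; last exact: measurable_tnth.
by apply: measurable_funM => //; exact: measurable_horner.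
Qed.

Section expansion_of.
Variable f : 'rV[R]_d -> R.
Hypothesis mf : measurable_fun setT (f \o @row_of_tuple R d).
Hypothesis f2 : gauss_integrable (fun x => f x ^+ 2).

Lemma gauss_integrableM (h : 'rV[R]_d -> R) :
  measurable_fun setT (h \o @row_of_tuple R d) ->
  gauss_integrable (fun x => h x ^+ 2) -> gauss_integrable (fun x => f x * h x).
Proof.
move=> mh h2.
have := integrableD measurableT f2 h2; rewrite /gauss_integrable.
under eq_fun do rewrite -EFinD -mulrDl.
apply: le_integrable_EFin => [|t].
  apply: measurable_funM; last exact: measurable_gauss_density.
  exact: measurable_funM mf mh.
rewrite normrM (ger0_norm (gauss_density_ge0 _)) ler_wpM2r ?gauss_density_ge0//.
move: (f _) (h _) => u v; rewrite ler_norml; nra.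
Qed.

Lemma gauss_integrable_hermite (k : {ffun 'I_d -> nat}) :
  gauss_integrable (fun x => f x * hermite k x).
Proof.
apply: gauss_integrableM; first exact: measurable_hermite.
exact: (gauss_hermite_sqr k).1.
Qed.

Lemma gauss_integral_abel_sum r x N :
  gauss_integral (fun y => f y * hermite_abel_sum r (fun k => hermite k y) x N) =
  hermite_abel_sum r (hermite_coef f) x N.
Proof.
rewrite /gauss_integral /Rintegral.
transitivity (fine (\int[lebesgue_tuple R d]_t \sum_(k : {ffun 'I_d -> 'I_N})
   ((r ^+ (\sum_i box k i) * hermite (box k) x)%:E *
    (f (row_of_tuple t) * hermite (box k) (row_of_tuple t) *
     gauss_density (row_of_tuple t))%:E))%E).
  congr fine; apply: eq_integral => t _.
  rewrite /hermite_abel_sum mulr_sumr mulr_suml -sumEFin; apply: eq_bigr => k _.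
  by rewrite -EFinM; congr _%:E; ring.
have ik k := gauss_integrable_hermite k.
rewrite integral_sum//; last by move=> k; apply: integrableZl => //; exact: ik.
under eq_bigr => k _.
  rewrite integralZl//; last exact: ik.
  rewrite -[X in (_ * X)%E]fineK; last exact: (integrable_fin_num measurableT (ik _)).
  rewrite -EFinM.
  over.
rewrite sumEFin/=; apply: eq_bigr => k _.
by rewrite -mulrA (mulrC (hermite _ _)).
Qed.

(** A truncated Abel mean is the integral of f against the truncated kernel. Dominated convergence
    applies with the majorant f(y)^2 + M(x,x) M(y,y), M being the kernel, which comes from |u v| <=
    u^2 + v^2. *)
Lemma abel_sum_cvg r x : 0 <= r < 1 ->
  gauss_integrable (fun y => f y * mehler_row r x y) /\
  hermite_abel_sum r (hermite_coef f) x N @[N --> \oo] -->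
    gauss_integral (fun y => f y * mehler_row r x y).
Proof.
move=> r01.
have [iM _] := gauss_prod (fun i : 'I_d => integrable_mehler_diag r01).
pose g (t : d.-tuple T) := f (row_of_tuple t) ^+ 2 * gauss_density (row_of_tuple t) +
  mehler_row r x x * (mehler_row r (row_of_tuple t) (row_of_tuple t) *
    gauss_density (row_of_tuple t)).
pose F N (t : d.-tuple T) := f (row_of_tuple t) *
  hermite_abel_sum r (fun k => hermite k (row_of_tuple t)) x N * gauss_density (row_of_tuple t).
have ig : (lebesgue_tuple R d).-integrable setT (EFin \o g).
  have := integrableD measurableT f2 (integrableZ_EFin (mehler_row r x x) iM).
  by apply: eq_integrable => // t _ /=; rewrite -EFinD.
have := @dominated_convergence _ _ R (lebesgue_tuple R d) setT measurableT
  (fun N => EFin \o F N)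
  (EFin \o (fun t => f (row_of_tuple t) * mehler_row r x (row_of_tuple t) *
     gauss_density (row_of_tuple t))) (EFin \o g).
case.
- move=> N; apply/measurable_EFinP; apply: measurable_funM; last exact: measurable_gauss_density.
  apply: measurable_funM => //; apply: measurable_sum => k.
  apply: measurable_funM => //; apply: measurable_funM => //; exact: measurable_hermite.
- apply/measurable_EFinP; apply: measurable_funM; last exact: measurable_gauss_density.
  by apply: measurable_funM => //; exact: measurable_mehler_row.
- apply/aeW => t _; apply: cvg_EFin; first exact: nearW.
  by apply: cvgMl; apply: cvgMr; exact: cvg_hermite_abel_sum.
- exact: ig.
- apply/aeW => t N _; rewrite /= lee_fin /F /g.
  rewrite normrM (ger0_norm (gauss_density_ge0 _)) mulrA -mulrDl.
  rewrite ler_wpM2r ?gauss_density_ge0//.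
  have := hermite_abel_sum_sqr_le x (row_of_tuple t) N r01.
  move: (f _) (hermite_abel_sum _ _ _ _) (_ * _) => u v w vw.
  by rewrite ler_norml; nra.
move=> H1 _ H2; split; first exact: H1.
under eq_fun do rewrite -gauss_integral_abel_sum.
apply: fine_cvg; rewrite /gauss_integral /Rintegral fineK; first exact: H2.
exact: (integrable_fin_num measurableT H1).
Qed.

End expansion_of.

(** The case f = 1: the only nonzero coefficient is the one at 0, so the Abel sums are constantly
    1. *)
Lemma mehler_row_gauss_integral r x : 0 <= r < 1 ->
  gauss_integrable (mehler_row r x) /\ gauss_integral (mehler_row r x) = 1.
Proof.
move=> r01.
have m1 : measurable_fun setT ((cst 1 : 'rV[R]_d -> R) \o @row_of_tuple R d).
  exact: measurable_cst.
have i1 : gauss_integrable (fun x : 'rV[R]_d => cst 1 x ^+ 2).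
  rewrite (_ : (fun x => _) = cst 1); first exact: (gauss_integral1 d).1.
  by apply/funext => y; rewrite /= expr1n.
have [H1 H2] := abel_sum_cvg m1 i1 x r01.
have E : (fun y => cst 1 y * mehler_row r x y) = mehler_row r x.
  by apply/funext => y; rewrite mul1r.
rewrite E in H1 H2; split => //.
suff H3 : hermite_abel_sum r (hermite_coef (cst 1)) x N @[N --> \oo] --> (1 : R).
  exact: (cvg_unique _ H2 H3).
(* For N = 0 and d > 0 the cube is empty; from N = 1 on it contains the index 0. *)
rewrite -cvg_shiftS.
suff -> : (fun N => hermite_abel_sum r (hermite_coef (cst 1)) x N.+1) = cst 1.
  exact: cvg_cst.
apply/funext => N.
pose k0 : {ffun 'I_d -> 'I_N.+1} := [ffun=> ord0].
have bk0 : box k0 = [ffun=> 0%N] by apply/ffunP => i; rewrite !ffunE.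
have C k : hermite_coef (cst 1 : 'rV[R]_d -> R) k = (k == [ffun=> 0%N])%:R.
  rewrite -(gauss_hermite k).2; congr gauss_integral.
  by apply/funext => y; rewrite mul1r.
rewrite /hermite_abel_sum (bigD1 k0)//= bk0 C eqxx mul1r hermite_ffun0 mulr1.
rewrite big1 ?expr0 ?addr0; last by move=> i _; rewrite ffunE.
rewrite big1 ?addr0// => k kk0; rewrite C (_ : _ == _ = false) ?mul0r ?mulr0//.
apply: contra_neqF kk0 => /eqP/ffunP bk; apply/ffunP => i; apply/val_inj.
by have := bk i; rewrite !ffunE.
Qed.

(** Completing the square leaves the exponent unchanged; the only loss is 1 / sqrt u <= 1 / u with u
    = 1 - r^2 <= 1, made to have integer powers of u later. *)
Lemma mehler_le r s t : 0 <= r < 1 ->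
  mehler r s t <= (1 - r ^+ 2)^-1 * expR (s ^+ 2 / 2) *
    expR (- (r * t - s) ^+ 2 / (2 * (1 - r ^+ 2))).
Proof.
move=> /andP[r0 r1].
have u0 : 0 < 1 - r ^+ 2 by rewrite subr_gt0 expr_lt1.
rewrite -mulrA -expRD /mehler.
rewrite (_ : s ^+ 2 / 2 + _ =
  (2 * r * s * t - r ^+ 2 * (s ^+ 2 + t ^+ 2)) / (2 * (1 - r ^+ 2))); last first.
  by field; rewrite gt_eqF.
rewrite ler_wpM2r ?expR_ge0// lef_pV2 ?posrE ?sqrtr_gt0//.
have u1 : 1 - r ^+ 2 <= 1 by rewrite gerBl sqr_ge0.
move: u0 u1; move: (1 - r ^+ 2) => u u0 u1.
rewrite -{1}(sqr_sqrtr (ltW u0)) expr2 ler_piMr ?sqrtr_ge0//.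
by rewrite -sqrtr1 ler_sqrt.
Qed.

(* Away from the diagonal the Gaussian factor [exp (- c / (1 - r^2))] of one
   coordinate beats the singular prefactors of all of them. *)
Lemma mehler_row_off_diag x (e : R) : 0 < e -> exists C : R,
  \forall r \near 1^'-, forall y, (exists i, e <= `|y 0 i - x 0 i|) ->
    mehler_row r x y <= C * (1 - r).
Proof.
move=> e0.
(* The far coordinate will satisfy |r y - x| >= e/2, so its exponent is at least (e/2)^2 / (2 u) = a
   / u. *)
pose a := e ^+ 2 / 8.
pose E := \prod_(i < d) expR (x 0 i ^+ 2 / 2).
pose X := \sum_(i < d) `|x 0 i|.
have a0 : 0 < a by rewrite divr_gt0// exprn_gt0.
have E0 : 0 < E by apply: prodr_gt0 => i _; exact: expR_gt0.
have X0 : 0 <= X by apply: sumr_ge0.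
(* From exp (- z) <= (d+1)! / z^(d+1) at z = a / u: against the prefactor u^(-d) one power of u is
   left, and u <= 2 (1 - r). *)
exists (E * (d.+1`!%:R / a ^+ d.+1) * 2); near=> r => y [i ei].
(* The two conditions r > 3/4 and (1 - r) (X + 1) <= e/4 give |r y - x| >= 3e/4 - e/4; the + 1
   covers x = 0. *)
have r34 : 3 / 4 < r by near: r; apply: nbhs_left_gt; rewrite ltr_pdivrMr// mul1r ltr_nat.
have r1 : r < 1 by near: r; exact: nbhs_left_lt.
have rX : 1 - e / (4 * (X + 1)) < r.
  by near: r; apply: nbhs_left_gt; rewrite gtrBl divr_gt0// mulr_gt0// ltr_wpDl.
have r0 : 0 < r by rewrite (lt_trans _ r34)// divr_gt0.
have r01 : 0 <= r < 1 by rewrite ltW.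
set u := 1 - r ^+ 2.
have u0 : 0 < u by rewrite subr_gt0 expr_lt1// ltW.
have u1 : u <= 2 * (1 - r) by rewrite /u; nra.
have dist : e / 2 <= `|r * y 0 i - x 0 i|.
  have -> : r * y 0 i - x 0 i = r * (y 0 i - x 0 i) - (1 - r) * x 0 i by ring.
  rewrite (le_trans _ (lerB_dist _ _))// !normrM (gtr0_norm r0).
  rewrite (gtr0_norm (_ : 0 < 1 - r)) ?subr_gt0//.
  have xX : `|x 0 i| <= X by rewrite /X (bigD1 i)//= lerDl sumr_ge0.
  have h1 : r * e <= r * `|y 0 i - x 0 i| by rewrite ler_pM2l.
  have h2 : (1 - r) * `|x 0 i| <= (1 - r) * (X + 1).
    by rewrite ler_pM2l ?subr_gt0// (le_trans xX)// lerDl.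
  have h3 : (1 - r) * (X + 1) <= e / 4.
    rewrite -ler_pdivlMr ?ltr_wpDl//.
    have : e / (4 * (X + 1)) = e / 4 / (X + 1) by field; rewrite gt_eqF// ltr_wpDl.
    by move: rX => /[swap] ->; lra.
  have h4 : 3 / 4 * e <= r * e by rewrite ler_pM2r// ltW.
  lra.
pose b j := (r * y 0 j - x 0 j) ^+ 2 / (2 * u).
have b0 j : 0 <= b j by rewrite divr_ge0 ?sqr_ge0 ?mulr_ge0// ltW.
have H : mehler_row r x y <= u^-1 ^+ d * E * expR (- (a / u)).
  apply: (@le_trans _ _ (\prod_(j < d) (u^-1 * expR (x 0 j ^+ 2 / 2) * expR (- b j)))).
    apply: ler_prod => j _; apply/andP; split.
      by rewrite ltW// mehler_gt0// gtr0_norm.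
    by have := mehler_le (x 0 j) (y 0 j) r01; rewrite /b mulNr.
  rewrite !big_split/= prodr_const card_ord ler_wpM2l//.
    by rewrite mulr_ge0 ?exprn_ge0 ?invr_ge0 ?ltW.
  rewrite (bigD1 i)//= -[leRHS]mulr1; apply: ler_pM; rewrite ?expR_ge0//.
  - by apply: prodr_ge0 => j _; exact: expR_ge0.
  - rewrite ler_expR lerN2 /b /a invfM !mulrA ler_wpM2r ?invr_ge0 ?(ltW u0)//.
    rewrite -(real_normK (num_real (r * y 0 i - x 0 i))).
    have := @lerXn2r R 2 (e / 2) `|r * y 0 i - x 0 i|.
    rewrite !nnegrE ?divr_ge0 ?normr_ge0 ?(ltW e0)// => /(_ isT isT dist).
    by rewrite expr_div_n; lra.
  - apply: (@le_trans _ _ (\prod_(j < d | j != i) (1 : R))); last by rewrite big1.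
    by apply: ler_prod => j _; rewrite expR_ge0/= -[leRHS]expR0 ler_expR oppr_le0.
apply: (le_trans H).
have au0 : 0 < a / u by rewrite divr_gt0.
have : expR (- (a / u)) <= d.+1`!%:R / (a / u) ^+ d.+1.
  rewrite expRN -[leRHS]invrK lef_pV2 ?posrE ?expR_gt0
    ?invr_gt0 ?divr_gt0 ?exprn_gt0 ?ltr0n ?fact_gt0//.
  rewrite invfM invrK mulrC.
  by have := expR_ge1Dxn d (ltW au0); apply: le_trans; rewrite lerDr.
move=> /(ler_wpM2l (_ : 0 <= u^-1 ^+ d * E)) => /(_ _) /le_trans; apply.
  by rewrite mulr_ge0 ?exprn_ge0 ?invr_ge0 ?ltW.
rewrite [leLHS](_ : _ = E * (d.+1`!%:R / a ^+ d.+1) * u); last first.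
  rewrite expr_div_n invf_div exprVn exprS.
  by field; rewrite !expf_neq0 ?gt_eqF// exprn_gt0.
rewrite -[leRHS]mulrA ler_wpM2l// mulr_ge0 ?(ltW E0)//.
by rewrite divr_ge0// exprn_ge0// ltW.
Unshelve. all: by end_near. Qed.

(** The kernel has Gaussian mean 1, so f(x) - (average of f) is the average of f(x) - f(y). Near x
    continuity makes this small; elsewhere the kernel is O(1 - r) against |f(y)| + |f(x)|, which is
    integrable since |f| <= f^2 + 1. *)
Lemma mehler_row_approx (f : 'rV[R]_d -> R) x : continuous f ->
  gauss_integrable (fun x => f x ^+ 2) ->
  gauss_integral (fun y => f y * mehler_row r x y) @[r --> 1^'-] --> f x.
Proof.
move=> cf f2; have mf := continuous_measurable_row cf.
have m1 : measurable_fun setT ((cst 1 : 'rV[R]_d -> R) \o @row_of_tuple R d).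
  exact: measurable_cst.
have i1 : gauss_integrable (cst 1 : 'rV[R]_d -> R) by exact: (gauss_integral1 d).1.
have ifx : gauss_integrable (fun y => `|f y| + `|f x|).
  have := integrableD measurableT f2 (integrableZ_EFin (1 + `|f x|) i1).
  rewrite /gauss_integrable; under eq_fun do rewrite -EFinD.
  apply: le_integrable_EFin => [|t].
    apply: measurable_funM; last exact: measurable_gauss_density.
    by apply: measurable_funD => //; exact: measurableT_comp.
  rewrite normrM (ger0_norm (gauss_density_ge0 _)) mul1r -mulrDl.
  rewrite ler_wpM2r ?gauss_density_ge0// ger0_norm ?addr_ge0// addrA lerD2r.
  by rewrite -real_normK ?num_real//; move: `|f _| => u; nra.
pose D := gauss_integral (fun y => `|f y| + `|f x|).
have D0 : 0 <= D.
  by apply: Rintegral_ge0 => t _; rewrite mulr_ge0 ?addr_ge0 ?gauss_density_ge0.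
apply/cvgrPdist_le => e e0.
have e2 : 0 < e / 2 by rewrite divr_gt0.
have /cvg_ballP/(_ _ e2) := cf x.
rewrite -/(nbhs _ _) => /nbhs_ballP[s /= s0 Hs].
have [C HC] := mehler_row_off_diag x s0.
have k0 : 0 < `|C| * D + 1 by rewrite ltr_wpDl// mulr_ge0.
near=> r.
have r1 : r < 1 by near: r; exact: nbhs_left_lt.
have r0 : 0 < r by near: r; apply: nbhs_left_gt.
have r01 : 0 <= r < 1 by rewrite ltW.
have Hoff : forall y, (exists i, s <= `|y 0 i - x 0 i|) ->
    mehler_row r x y <= C * (1 - r) by near: r.
have rC : `|C| * (1 - r) * D <= e / 2.
  have : 1 - e / 2 / (`|C| * D + 1) < r.
    by near: r; apply: nbhs_left_gt; rewrite gtrBl divr_gt0//.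
  rewrite ltrBlDl -ltrBlDr ltr_pdivlMr// => /ltW; apply: le_trans.
  by rewrite mulrAC mulrC ler_wpM2l ?subr_ge0 ?(ltW r1)// lerDl.
have [iM M1] := mehler_row_gauss_integral x r01.
have [ifM _] := abel_sum_cvg mf f2 x r01.
have -> : f x = gauss_integral (fun y => f x * mehler_row r x y).
  rewrite /gauss_integral; under eq_Rintegral do rewrite -mulrA.
  by rewrite RintegralZl// -/(gauss_integral _) M1 mulr1.
have ifM' : gauss_integrable (fun y => f x * mehler_row r x y).
  rewrite /gauss_integrable; under eq_fun do rewrite -mulrA.
  exact: integrableZ_EFin iM.
rewrite /gauss_integral -RintegralB//.
have iB : (lebesgue_tuple R d).-integrable setT (EFin \o (fun t =>
    f x * mehler_row r x (row_of_tuple t) * gauss_density (row_of_tuple t) -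
    f (row_of_tuple t) * mehler_row r x (row_of_tuple t) * gauss_density (row_of_tuple t))).
  by have := integrableB measurableT ifM' ifM; apply: eq_integrable.
apply: (le_trans (le_normr_Rintegral measurableT iB)).
have -> : e = e / 2 * gauss_integral (mehler_row r x) + e / 2 by rewrite M1; field.
apply: (@le_trans _ _ (e / 2 * gauss_integral (mehler_row r x) + `|C| * (1 - r) * D)).
  rewrite /D /gauss_integral -!RintegralZl// -RintegralD//; last 2 first.
  - exact: integrableZ_EFin iM.
  - exact: integrableZ_EFin ifx.
  apply: le_Rintegral => //.
  - exact: (integrable_norm iB).
  - have := integrableD measurableT (integrableZ_EFin (e / 2) iM)
      (integrableZ_EFin (`|C| * (1 - r)) ifx).
    by apply: eq_integrable.
  move=> t _; have := gauss_density_ge0 (row_of_tuple t).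
  move: (gauss_density (row_of_tuple t)) => g g0.
  rewrite -!mulrBl normrM (ger0_norm g0) !mulrA -mulrDl ler_wpM2r// normrM.
  have Mt := mehler_row_ge0 x (row_of_tuple t) r01.
  rewrite (ger0_norm Mt); set y := row_of_tuple t in Mt *.
  have [[i Hi]|near_x] := pselect (exists i, s <= `|y 0 i - x 0 i|).
    rewrite -[leLHS]add0r; apply: lerD; first exact: mulr_ge0 (ltW e2) Mt.
    rewrite mulrC; apply: ler_pM => //.
      rewrite (le_trans (Hoff _ _))//; first by exists i.
      by rewrite ler_wpM2r ?subr_ge0 ?(ltW r1)// ler_norm.
    by rewrite (le_trans (ler_normB _ _))// addrC.
  rewrite -[leLHS]addr0; apply: lerD; last first.
    by rewrite mulr_ge0 ?addr_ge0// mulr_ge0 ?subr_ge0 ?(ltW r1).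
  rewrite ler_wpM2r// ltW//.
  suff : ball x s y by move=> /Hs; rewrite -ball_normE.
  split=> // i j; rewrite ord1 -ball_normE /ball_/= distrC ltNge.
  by apply/negP => H; apply: near_x; exists j.
by rewrite lerD2l.
Unshelve. all: by end_near. Qed.

End mehler_expansion.

(** * Choice of the points and the worst-case error bound *)

Lemma cvg_sumr (R : realFieldType) (J I : Type) (F : set_system J) (FF : Filter F)
    (s : seq I) (u : I -> J -> R) (l : I -> R) :
  (forall i, u i x @[x --> F] --> l i) ->
  \sum_(i <- s) u i x @[x --> F] --> \sum_(i <- s) l i.
Proof.
move=> ul; elim: s => [|i s IH].
  by rewrite big_nil; under eq_fun do rewrite big_nil; exact: cvg_cst.
by rewrite big_cons; under eq_fun do rewrite big_cons; exact: cvgD.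
Qed.

Section point_selection.
Context {R : realType} (d : nat).
Local Notation T := (measurableTypeR R).
Local Notation idx := ({ffun 'I_d -> nat}).
Implicit Types (c S : idx -> R) (v w : idx -> R).

Lemma box_inj N : injective (@box d N).
Proof.
move=> k l /ffunP kl; apply/ffunP => i; apply/val_inj.
by have := kl i; rewrite !ffunE.
Qed.

Lemma ler_sum_box c N M : (forall k, 0 <= c k) -> (N <= M)%N ->
  \sum_(k : {ffun 'I_d -> 'I_N}) c (box k) <= \sum_(k : {ffun 'I_d -> 'I_M}) c (box k).
Proof.
move=> c0 NM.
pose emb (k : {ffun 'I_d -> 'I_N}) : {ffun 'I_d -> 'I_M} := [ffun i => widen_ord NM (k i)].
have bemb k : box (emb k) = box k by apply/ffunP => i; rewrite !ffunE.
have inj : injective emb by move=> k l kl; apply: box_inj; rewrite -!bemb kl.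
under eq_bigr do rewrite -bemb.
rewrite -(big_imset (fun k => c (box k)) (in2W inj))/=.
by rewrite big_mkcond/=; apply: ler_sum => k _; case: ifP.
Qed.

(* The squared worst-case error of a point set is [discrepancy] of
   [S k = \sum_i hermite k (x_i)], divided by the squared number of points and
   in the limit [N --> oo]. *)
Definition discrepancy w S N : R :=
  \sum_(k : {ffun 'I_d -> 'I_N})
    (box k != [ffun=> 0%N])%:R * w (box k) * S (box k) ^+ 2.

Section weights.
Variables (w : idx -> R) (V : R).
Hypothesis w0 : forall k, 0 < w k.
Hypothesis w1 : w [ffun=> 0%N] = 1.
Hypothesis wV : forall N, \sum_(k : {ffun 'I_d -> 'I_N}) w (box k) <= V.

Let v k : R := (k != [ffun=> 0%N])%:R * w k.

Let v_ge0 k : 0 <= v k.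
Proof. by rewrite mulr_ge0// ltW. Qed.

Lemma discrepancy_ge0 S N : 0 <= discrepancy w S N.
Proof. by apply: sumr_ge0 => k _; rewrite mulr_ge0 ?sqr_ge0// v_ge0. Qed.

Let sum_v N : \sum_(k : {ffun 'I_d -> 'I_N}) v (box k) <= V - 1.
Proof.
(* Enlarging the cube ensures that it contains the index 0, whose weight 1 is what V - 1 saves. *)
apply: (@le_trans _ _ (\sum_(k : {ffun 'I_d -> 'I_N.+1}) v (box k))).
  exact: ler_sum_box.
pose k0 : {ffun 'I_d -> 'I_N.+1} := [ffun=> ord0].
have bk0 : box k0 = [ffun=> 0%N] by apply/ffunP => i; rewrite !ffunE.
rewrite lerBrDr; apply: le_trans (wV N.+1).
rewrite (bigD1 k0)//= [leRHS](bigD1 k0)//= bk0 w1 /v eqxx mul0r add0r [leLHS]addrC lerD2l.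
apply: ler_sum => k kk0; rewrite -bk0 (inj_eq (@box_inj _)) kk0 mul1r//.
Qed.

Lemma gauss_integral_discrepancy S N :
  (\int[lebesgue_tuple R d]_t
    (discrepancy w (fun k => (S k + hermite k (row_of_tuple t))%R) N *
     gauss_density (row_of_tuple t))%:E <= (discrepancy w S N + (V - 1))%:E)%E.
Proof.
have [i1 e1] := gauss_integral1 (R := R) d.
have i1' (k : idx) := (gauss_hermite (R := R) k).1.
have i2 (k : idx) := (gauss_hermite_sqr (R := R) k).1.
pose g (t : d.-tuple T) := gauss_density (row_of_tuple t) : R.
pose h k (t : d.-tuple T) := hermite k (row_of_tuple t) : R.
have ig : (lebesgue_tuple R d).-integrable setT (EFin \o g).
  by apply: eq_integrable i1 => // t _; rewrite /= mul1r.
pose E k (t : d.-tuple T) : \bar R := ((v k * S k ^+ 2)%:E * (g t)%:E +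
  ((2 * v k * S k)%:E * (h k t * g t)%:E + (v k)%:E * (h k t ^+ 2 * g t)%:E))%E.
have iE1 k := integrableZl measurableT (v k * S k ^+ 2) ig.
have iE2 k := integrableZl measurableT (2 * v k * S k) (i1' k).
have iE3 k := integrableZl measurableT (v k) (i2 k).
have iE23 k := integrableD measurableT (iE2 k) (iE3 k).
have iE k : (lebesgue_tuple R d).-integrable setT (E k).
  by have := integrableD measurableT (iE1 k) (iE23 k); apply: eq_integrable.
have fg (f : d.-tuple T -> R) : (lebesgue_tuple R d).-integrable setT (EFin \o f) ->
    (\int[lebesgue_tuple R d]_t (f t)%:E = (\int[lebesgue_tuple R d]_t f t)%:E)%E.
  by move=> fi; rewrite /Rintegral fineK//; exact: (integrable_fin_num measurableT fi).
have IE k : (\int[lebesgue_tuple R d]_t E k t = (v k * S k ^+ 2 + v k)%:E)%E.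
  apply: (etrans (integralD measurableT (iE1 k) (iE23 k))).
  rewrite [X in (_ + X)%E](integralD measurableT (iE2 k) (iE3 k)).
  rewrite (integralZl measurableT ig) (integralZl measurableT (i1' k)).
  rewrite (integralZl measurableT (i2 k)).
  rewrite (fg _ ig) (fg _ (i1' k)) (fg _ (i2 k)).
  rewrite [X in (_ * X%:E + _)%E](_ : _ = 1); last first.
    by rewrite -e1; apply: eq_Rintegral => t _; rewrite mul1r.
  have eh1 : \int[lebesgue_tuple R d]_t (hermite k (row_of_tuple t) *
    gauss_density (row_of_tuple t)) = (k == [ffun=> 0%N])%:R := (gauss_hermite k).2.
  have eh2 : \int[lebesgue_tuple R d]_t (hermite k (row_of_tuple t) ^+ 2 *
    gauss_density (row_of_tuple t)) = 1 := (gauss_hermite_sqr k).2.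
  rewrite eh1 eh2 -!EFinM -!EFinD !mulr1; congr _%:E.
  (* The cross term vanishes in both cases: [v] is zero at k = 0, and the Hermite function has mean
     zero at k <> 0. *)
  by rewrite /v; case: eqP => _ /=; ring.
have -> : (fun t => (discrepancy w (fun k => (S k + hermite k (row_of_tuple t))%R) N *
     gauss_density (row_of_tuple t))%:E) =
    (fun t => \sum_(k : {ffun 'I_d -> 'I_N}) E (box k) t)%E.
  apply/funext => t; rewrite /discrepancy mulr_suml -sumEFin; apply: eq_bigr => k _.
  by rewrite /E -!EFinM -!EFinD -/(v _) -/(h _ _) -/(g _); congr _%:E; ring.
rewrite integral_sum//; under eq_bigr do rewrite IE.
rewrite sumEFin lee_fin big_split/= lerD2l; exact: sum_v.
Qed.

Lemma measurable_discrepancy S N : measurable_fun setT (fun t : d.-tuple T =>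
  discrepancy w (fun k => S k + hermite k (row_of_tuple t)) N *
     gauss_density (row_of_tuple t)).
Proof.
apply: measurable_funM; last exact: measurable_gauss_density.
apply: measurable_sum => k; apply: measurable_funM => //; apply: measurable_funX.
by apply: measurable_funD => //; exact: measurable_hermite.
Qed.

(** If every x failed at some N, the increasing limit over N would be at least B + V everywhere,
    while by monotone convergence its Gaussian mean is at most B + V - 1. Giving up the 1 makes
    these weak inequalities contradictory. *)
Lemma add_point S (B : R) : (forall N, discrepancy w S N <= B) ->
  exists x : 'rV[R]_d, forall N,
    discrepancy w (fun k => S k + hermite k x) N <= B + V.
Proof.
move=> SB; apply: contrapT => /forallNP H.
have {}H x : exists N, B + V < discrepancy w (fun k => S k + hermite k x) N.
  by have /existsNP[N /negP] := H x; rewrite -ltNge; exists N.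
pose G N (t : d.-tuple T) : \bar R :=
  (discrepancy w (fun k => S k + hermite k (row_of_tuple t)) N *
     gauss_density (row_of_tuple t))%:E.
have mG N : measurable_fun setT (G N).
  by apply/measurable_EFinP; exact: measurable_discrepancy.
have G0 N t : setT t -> (0 <= G N t)%E.
  by move=> _; rewrite lee_fin mulr_ge0 ?discrepancy_ge0 ?gauss_density_ge0.
have ndG t : setT t -> {homo G^~ t : n m / (n <= m)%N >-> (n <= m)%E}.
  move=> _ n m nm; rewrite lee_fin ler_wpM2r ?gauss_density_ge0//.
  apply: (ler_sum_box (c := fun k => v k * (S k + hermite k (row_of_tuple t)) ^+ 2)) => //.
  by move=> k; rewrite mulr_ge0 ?sqr_ge0.
have := monotone_convergence (lebesgue_tuple R d) measurableT mG G0 ndG.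
have ub : (limn (fun N => \int[lebesgue_tuple R d]_t G N t) <= (B + (V - 1))%:E)%E.
  apply: lime_le.
    apply: ereal_nondecreasing_is_cvgn => n m nm.
    by apply: ge0_le_integral => // t _; [exact: G0|exact: ndG].
  apply: nearW => N; apply: (le_trans (gauss_integral_discrepancy S N)).
  by rewrite lee_fin lerD2r.
have [i1 e1] := gauss_integral1 (R := R) d.
have lb : ((B + V)%:E <= \int[lebesgue_tuple R d]_t limn (G ^~ t))%E.
  have B0 : 0 <= B by apply: le_trans (SB 0%N); exact: discrepancy_ge0.
  have V0 : 0 <= V by apply: le_trans (wV 0%N); apply: sumr_ge0 => k _; exact: ltW.
  have -> : (B + V)%:E = (\int[lebesgue_tuple R d]_t
      ((B + V) * (1 * gauss_density (row_of_tuple t)))%:E)%E.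
    under eq_integral do rewrite EFinM.
    rewrite (integralZl measurableT i1) [X in (_ * X)%E](_ : _ = 1%E) ?mule1//.
    rewrite -[LHS]fineK; last exact: (integrable_fin_num measurableT i1).
    by congr _%:E; exact: e1.
  apply: ge0_le_integral => //.
  - by move=> t _; rewrite lee_fin mul1r mulr_ge0 ?addr_ge0 ?gauss_density_ge0.
  - apply/measurable_EFinP; apply: measurable_funM => //.
    by apply: measurable_funM => //; exact: measurable_gauss_density.
  - apply: (emeasurable_fun_cvg G) => // t _.
    by apply: ereal_nondecreasing_is_cvgn; exact: ndG.
  - move=> t _; have [N HN] := H (row_of_tuple t).
    apply: (@le_trans _ _ (G N t)).
      by rewrite lee_fin mul1r ler_wpM2r ?gauss_density_ge0// ltW.
    apply: lime_ge; first by apply: ereal_nondecreasing_is_cvgn; exact: ndG.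
    by exists N => // M /= NM; exact: ndG.
move=> E; move: lb; rewrite E => /le_trans/(_ ub).
by rewrite lee_fin; lra.
Qed.

Lemma exists_points n : exists x : 'I_n -> 'rV[R]_d, forall N,
  discrepancy w (fun k => \sum_(i < n) hermite k (x i)) N <= n%:R * V.
Proof.
elim: n => [|n [x Hx]].
  exists (fun=> 0) => N; rewrite mul0r /discrepancy big1// => k _.
  by rewrite big_ord0 expr0n/= mulr0.
have [y Hy] := add_point Hx.
exists (fun i => oapp x y (unlift ord_max i)) => N.
rewrite -natr1 mulrDl mul1r; apply: le_trans (Hy N).
rewrite le_eqVlt; apply/orP; left; apply/eqP; apply: eq_bigr => k _; congr (_ * _ ^+ 2).
rewrite big_ord_recr/= unlift_none/=; congr (_ + _); apply: eq_bigr => i _.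
rewrite (_ : widen_ord _ i = lift ord_max i) ?liftK//.
by apply/val_inj; rewrite /= /bump leqNgt ltn_ord.
Qed.

Section error_bound.
Variables (n : nat) (x : 'I_n -> 'rV[R]_d) (Q : R).
Hypothesis xQ : forall N,
  discrepancy w (fun k => \sum_(i < n) hermite k (x i)) N <= Q.
Variable f : 'rV[R]_d -> R.
Hypothesis fw : hermite_space w f.
Hypothesis f1 : (hermite_norm w f <= 1)%E.

Lemma sum_box_hermite_coef_le1 N :
  \sum_(k : {ffun 'I_d -> 'I_N}) (w (box k))^-1 * hermite_coef f (box k) ^+ 2 <= 1.
Proof.
have : (\esum_(k in [set: idx]) ((w k)^-1 * `|hermite_coef f k| ^+ 2)%:E <= 1)%E.
  have s1 : sqrte 1%E = 1%E :> \bar R by rewrite /sqrte sqrtr1.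
  by have := f1; rewrite /hermite_norm -[X in (_ <= X)%E]s1 lee_sqrt// lee_fin.
rewrite -lee_fin; apply: le_trans; apply: esum_ge.
exists [set` [seq box k | k : {ffun 'I_d -> 'I_N}]].
  by split => //; exact: finite_seq.
rewrite -fsbig_seq; last by rewrite map_inj_uniq ?enum_uniq//; exact: box_inj.
rewrite big_map big_enum/= -sumEFin le_eqVlt; apply/orP; left; apply/eqP.
by apply: eq_bigr => k _; rewrite real_normK ?num_real.
Qed.

Let S k := \sum_(i < n) hermite k (x i).

Let c0 : hermite_coef f [ffun=> 0%N] = gauss_integral f.
Proof.
by rewrite /hermite_coef; congr gauss_integral; apply/funext => y;
  rewrite hermite_ffun0 mulr1.
Qed.

(** The index 0, present in every cube of side N + 1, contributes exactly n times the integral. For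
    the rest, Cauchy-Schwarz with weights 1/w separates the coefficients, of norm at most 1, from
    the discrepancy, where the squared Abel factors are at most 1. *)
Lemma abel_sum_error r N : 0 <= r < 1 ->
  (\sum_(i < n) hermite_abel_sum r (hermite_coef f) (x i) N.+1 -
   n%:R * gauss_integral f) ^+ 2 <= Q.
Proof.
move=> /andP[r0 r1].
pose k0 : {ffun 'I_d -> 'I_N.+1} := [ffun=> ord0].
have bk0 : box k0 = [ffun=> 0%N] by apply/ffunP => i; rewrite !ffunE.
pose u (k : {ffun 'I_d -> 'I_N.+1}) := (box k != [ffun=> 0%N])%:R * (w (box k))^-1.
pose e (k : {ffun 'I_d -> 'I_N.+1}) := r ^+ (\sum_i box k i).
have e1 k : e k ^+ 2 <= 1 by rewrite /e -exprM exprn_ile1// ltW.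
have -> : \sum_(i < n) hermite_abel_sum r (hermite_coef f) (x i) N.+1 -
    n%:R * gauss_integral f =
    \sum_k u k * (hermite_coef f (box k) * (w (box k) * (e k * S (box k)))).
  rewrite exchange_big/= (bigD1 k0)//= [RHS](bigD1 k0)//= {1}/u bk0 eqxx mul0r mul0r add0r.
  rewrite [X in X + _ - _](_ : _ = n%:R * gauss_integral f).
    rewrite addrC addKr; apply: eq_bigr => k kk0.
    rewrite /u -bk0 (inj_eq (@box_inj _)) kk0 mul1r /S !mulr_sumr.
    by apply: eq_bigr => i _; rewrite /e; field; rewrite gt_eqF.
  under eq_bigr do rewrite hermite_ffun0 mulr1 c0.
  rewrite sumr_const card_ord big1 ?expr0 ?mul1r ?mulr_natl// => i _.
  by rewrite ffunE.
have u0 k : 0 <= u k by rewrite mulr_ge0// invr_ge0 ltW.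
apply: (le_trans (cauchy_schwarz_weighted _ _ u0)).
rewrite -[leRHS]mul1r; apply: ler_pM.
- by apply: sumr_ge0 => k _; rewrite mulr_ge0 ?sqr_ge0.
- by apply: sumr_ge0 => k _; rewrite mulr_ge0 ?sqr_ge0.
- apply: le_trans (sum_box_hermite_coef_le1 N.+1); apply: ler_sum => k _.
  rewrite ler_wpM2r ?sqr_ge0// /u; case: eqP => _ /=; rewrite ?mul1r// mul0r.
  by rewrite invr_ge0 ltW.
- apply: le_trans (xQ N.+1); apply: ler_sum => k _; rewrite !exprMn /u.
  have -> : (box k != [ffun=> 0%N])%:R * (w (box k))^-1 *
      (w (box k) ^+ 2 * (e k ^+ 2 * S (box k) ^+ 2)) =
      e k ^+ 2 * (v (box k) * S (box k) ^+ 2).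
    by rewrite /v; field; rewrite gt_eqF.
  by rewrite ler_piMl// mulr_ge0 ?sqr_ge0.
Qed.

(** Two successive limits, N -> oo at fixed r and then r -> 1, through a bound independent of
    both. *)
Lemma qmc_error_sqr_le :
  (\sum_(i < n) f (x i) - n%:R * gauss_integral f) ^+ 2 <= Q.
Proof.
have [cf f2 _] := fw; have mf := continuous_measurable_row cf.
pose I r i := gauss_integral (fun y => f y * mehler_row r (x i) y).
have Hr r : 0 <= r < 1 -> (\sum_(i < n) I r i - n%:R * gauss_integral f) ^+ 2 <= Q.
  move=> r01.
  have L : \sum_(i < n) hermite_abel_sum r (hermite_coef f) (x i) N.+1 -
      n%:R * gauss_integral f @[N --> \oo] -->
      \sum_(i < n) I r i - n%:R * gauss_integral f.
    apply: cvgB; last exact: cvg_cst.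
    apply: cvg_sumr => i.
    by have [_] := abel_sum_cvg mf f2 (x i) r01; rewrite -cvg_shiftS.
  rewrite expr2; apply: (ler_cvg_to (cvgM L L) (cvg_cst Q)); apply: nearW => N.
  by have := abel_sum_error N r01; rewrite expr2.
have L : \sum_(i < n) I r i - n%:R * gauss_integral f @[r --> 1^'-] -->
    \sum_(i < n) f (x i) - n%:R * gauss_integral f.
  apply: cvgB; last exact: cvg_cst.
  by apply: cvg_sumr => i; exact: mehler_row_approx.
rewrite expr2; apply: (ler_cvg_to (cvgM L L) (cvg_cst Q)); near=> r.
have r01 : 0 <= r < 1.
  apply/andP; split; first by near: r; exact: nbhs_left_ge.
  by near: r; exact: nbhs_left_lt.
by have := Hr r r01; rewrite expr2.
Unshelve. all: by end_near. Qed.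

End error_bound.

Lemma exists_qmc_points n (e : R) : (0 < n)%N -> 0 < e -> V <= n%:R * e ^+ 2 ->
  exists x : 'I_n -> 'rV[R]_d, (qmc_error w x <= e%:E)%E.
Proof.
move=> n0 e0 Vn; have [x Hx] := exists_points n; exists x.
apply: ge_ereal_sup => _ [f [fw f1] <-]; rewrite lee_fin.
have := qmc_error_sqr_le Hx fw f1.
have n0' : 0 < n%:R :> R by rewrite ltr0n.
set A := \sum_(i < n) f (x i); set J := gauss_integral f => H.
rewrite -(ler_pM2l n0') -[X in X * `|_|](gtr0_norm n0') -normrM.
rewrite mulrBr mulVKf ?gt_eqF// distrC.
have ne0 : 0 <= n%:R * e by rewrite mulr_ge0// ltW.
rewrite -ler_sqr ?nnegrE// real_normK ?num_real// (le_trans H)//.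
by rewrite exprMn expr2 -mulrA ler_pM2l.
Qed.

End weights.
End point_selection.

(** * Weights of polynomial decay and tractability *)

Section tractability.
Context {R : realType}.

(** Cauchy condensation: the dyadic block from 2^m to 2^(m+1) contributes at most 2^m 2^(- a m) =
    q^m. *)
Lemma poly_decay_series_bounded (a : R) : 1 < a -> exists Z : R, 1 <= Z /\
  forall N, \sum_(1 <= k < N) (k%:R : R) `^ (- a) <= Z.
Proof.
move=> a1; pose q : R := 2 `^ (1 - a).
have q0 : 0 < q by exact: powR_gt0.
have q1 : q < 1.
  by rewrite /q /powR gt_eqF// expR_lt1 pmulr_llt0 ?subr_lt0// ln_gt0 ?ltr1n.
have step m : \sum_(1 <= k < (2 ^ m)%N) (k%:R : R) `^ (- a) <= \sum_(i < m) q ^+ i.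
  elim: m => [|m IH]; first by rewrite big_geq// big_ord0.
  rewrite big_ord_recr/= (@big_cat_nat _ _ _ (2 ^ m))//=; last first.
  - by rewrite leq_exp2l.
  - by rewrite expn_gt0.
  apply: lerD => //.
  apply: (@le_trans _ _ (\sum_(2 ^ m <= k < (2 ^ m.+1)%N) ((2 ^ m)%:R : R) `^ (- a))).
    rewrite big_nat [leRHS]big_nat; apply: ler_sum => k /andP[mk _].
    have p0 : 0 < (2 ^ m)%:R :> R by rewrite ltr0n expn_gt0.
    rewrite !powRN lef_pV2 ?posrE ?powR_gt0//; last by rewrite (lt_le_trans p0)// ler_nat.
    by rewrite ge0_ler_powR ?nnegrE ?ler_nat// ltW// (lt_trans ltr01).
  have E2 : (2 ^ m)%:R = 2 `^ m%:R :> R by rewrite powR_mulrn// natrX.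
  rewrite sumr_const_nat expnS mul2n -addnn addnK -[leLHS]mulr_natl E2 -powRrM -powRD; last first.
    by rewrite pnatr_eq0 implybT.
  rewrite -(powR_mulrn _ (ltW q0)) /q -powRrM (_ : m%:R + _ = (1 - a) * m%:R)//.
  by ring.
exists (1 - q)^-1; split.
  by rewrite invf_ge1 ?subr_gt0// gerBl ltW.
move=> N; apply: (@le_trans _ _ (\sum_(1 <= k < (2 ^ N)%N) (k%:R : R) `^ (- a))).
  have [N1|N1] := leqP N 1%N; first by rewrite big_geq// sumr_ge0// => k _; exact: powR_ge0.
  rewrite [leRHS](@big_cat_nat _ _ _ N)//=; [|exact: ltnW|by rewrite ltnW// ltn_expl].
  by rewrite lerDl sumr_ge0// => k _; exact: powR_ge0.
apply: (le_trans (step N)).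
rewrite -[leRHS]mul1r ler_pdivlMr ?subr_gt0// mulrC -opprB mulNr -subrX1 opprB.
by rewrite gerBl exprn_ge0// ltW.
Qed.

Lemma ler_prod1D_expR (I : Type) (s : seq I) (u : I -> R) : (forall i, 0 <= u i) ->
  \prod_(i <- s) (1 + u i) <= expR (\sum_(i <- s) u i).
Proof.
move=> u0; rewrite expR_sum; apply: ler_prod => i _.
by rewrite expR_ge1Dx addr_ge0.
Qed.

Section poly_decay.
Variables (alpha gamma : nat -> R) (Z : R).
Hypothesis gamma_gt0 : forall j, 0 < gamma j.
Hypothesis Z1 : 1 <= Z.
Hypothesis HZ : forall j N, \sum_(1 <= k < N) (k%:R : R) `^ (- alpha j) <= Z.

Lemma poly_decay_gt0 d (k : {ffun 'I_d -> nat}) : 0 < poly_decay alpha gamma k.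
Proof.
apply: prodr_gt0 => j _; rewrite /poly_decay1; case: eqP => // /eqP k0.
by rewrite mulr_gt0// powR_gt0// ltr0n lt0n.
Qed.

Lemma poly_decay_ffun0 d : poly_decay alpha gamma ([ffun=> 0%N] : {ffun 'I_d -> nat}) = 1.
Proof. by rewrite /poly_decay big1// => i _; rewrite ffunE. Qed.

(** The sum over a cube factors into one-dimensional sums, each at most 1 + Z gamma_j, the 1 coming
    from k = 0. *)
Lemma sum_poly_decay_le d N :
  \sum_(k : {ffun 'I_d -> 'I_N}) poly_decay alpha gamma (box k) <=
  expR (Z * \sum_(j < d) gamma j).
Proof.
have Z0 : 0 <= Z by rewrite (le_trans ler01).
have -> : \sum_(k : {ffun 'I_d -> 'I_N}) poly_decay alpha gamma (box k) =
    \prod_(j < d) \sum_(k < N) poly_decay1 (alpha j) (gamma j) k.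
  rewrite bigA_distr_bigA/=; apply: eq_bigr => k _.
  by apply: eq_bigr => j _; rewrite ffunE.
rewrite mulr_sumr.
apply: le_trans (ler_prod1D_expR _ _); last by move=> j; rewrite mulr_ge0// ltW.
apply: ler_prod => j _; apply/andP; split.
  apply: sumr_ge0 => k _; rewrite /poly_decay1; case: eqP => // _.
  by rewrite mulr_ge0 ?powR_ge0// ltW.
rewrite -(big_mkord xpredT (poly_decay1 (alpha j) (gamma j))).
case: N => [|N]; first by rewrite big_geq// addr_ge0// mulr_ge0// ltW.
rewrite big_ltn//= {1}/poly_decay1 eqxx lerD2l.
rewrite big_nat (eq_bigr (fun k => gamma j * (k%:R : R) `^ (- alpha j))); last first.
  by move=> [|k].
by rewrite -big_nat -mulr_sumr mulrC ler_wpM2r// ltW.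
Qed.

Lemma n_min_poly_decay_le d (e : R) : 0 < e < 1 ->
  (n_min (@poly_decay R alpha gamma d) e <=
   (2 * expR (Z * \sum_(j < d) gamma j) * e `^ (- 2))%:E)%E.
Proof.
move=> /andP[e0 e1]; set V := expR _.
have Z0 : 0 <= Z by rewrite (le_trans ler01).
have V1 : 1 <= V.
  by rewrite -expR0 ler_expR mulr_ge0// sumr_ge0// => j _; exact: ltW.
have e2 : 0 < e ^+ 2 by rewrite exprn_gt0.
(* Since this quotient is at least 1, rounding it up to an integer at most doubles it; hence the
   constant 2. *)
have Ve : 1 <= V / e ^+ 2.
  by rewrite ler_pdivlMr// mul1r (le_trans _ V1)// expr_le1// ltW.
pose n := (Num.truncn (V / e ^+ 2)).+1.
have nV : V <= n%:R * e ^+ 2.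
  by rewrite -ler_pdivrMr// ltW// truncnS_gt.
have [x Hx] := exists_qmc_points (@poly_decay_gt0 d) (poly_decay_ffun0 d)
  (sum_poly_decay_le d) (ltn0Sn _ : (0 < n)%N) e0 nV.
apply: (@le_trans _ _ n%:R%:E).
  apply: ereal_inf_lbound; exists n => //; split => //; exists x.
  by rewrite poly_decay_ffun0 mulr1.
rewrite lee_fin powRN powR_mulrn ?(ltW e0)//.
have : (Num.truncn (V / e ^+ 2))%:R <= V / e ^+ 2 by rewrite truncn_le (le_trans ler01).
by rewrite /n -natr1 -mulrA; lra.
Qed.

End poly_decay.
End tractability.

Theorem theorem3p14 (R : realType) (alpha gamma : nat -> R)
    (gamma_gt0 : forall j, 0 < gamma j)
    (gamma_noninc : nonincreasing_seq gamma)
    (alpha_gt1 : forall j, 1 < alpha j)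
    (inf_alpha_gt1 : 1 < inf (range alpha)) :
  ((\sum_(0 <= j <oo) (gamma j)%:E < +oo)%E ->
     strongly_polynomially_tractable (poly_decay alpha gamma))
  /\
  ((limn_esup (fun d : nat =>
      ((\sum_(0 <= j < d) gamma j) / ln d%:R)%:E) < +oo)%E ->
     polynomially_tractable (poly_decay alpha gamma)).
Proof.
pose a0 := inf (range alpha).
have a0_le j : a0 <= alpha j.
  by apply: ge_inf; [exists 1 => _ [i _ <-]; exact: ltW|exists j].
have [Z [Z1 HZ]] := poly_decay_series_bounded inf_alpha_gt1.
(* The infimum being above 1 is what allows a single Z for all coordinates. *)
have HZa j N : \sum_(1 <= k < N) (k%:R : R) `^ (- alpha j) <= Z.
  apply: le_trans (HZ N); rewrite big_nat [leRHS]big_nat; apply: ler_sum => k /andP[k1 _].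
  by rewrite ler_powR ?ler1n// lerN2.
have Z0 : 0 < Z by rewrite (lt_le_trans ltr01).
have H := n_min_poly_decay_le gamma_gt0 Z1 HZa.
split => [Hs|Hs].
- pose G := fine (\sum_(0 <= j <oo) (gamma j)%:E)%E.
  have HG d : \sum_(j < d) gamma j <= G.
    rewrite -lee_fin fineK; last first.
      by rewrite ge0_fin_numE// nneseries_ge0// => j _ _; rewrite lee_fin ltW.
    rewrite -sumEFin -(big_mkord xpredT (fun j => (gamma j)%:E)).
    by apply: nneseries_lim_ge => j _ _; rewrite lee_fin ltW.
  exists (2 * expR (Z * G)), 2; split => //; first by rewrite mulr_gt0// expR_gt0.
  move=> d e d0 e01; apply: (le_trans (H d e e01)).
  rewrite lee_fin powRr0 mulr1 ler_wpM2r ?powR_ge0// ler_wpM2l// ler_expR.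
  by rewrite ler_wpM2l// ltW.
- have [C [d0 [C0 d01 HC]]] : exists C d0, [/\ 0 < C, (1 < d0)%N &
      forall d, (d0 <= d)%N -> \sum_(j < d) gamma j <= C * ln d%:R].
    move: Hs; rewrite /limn_esup /limf_esup => /ereal_inf_lt[_ [A [m _ mA] <-]].
    set s := ereal_sup _ => soo.
    (* Here s bounds the quotients from index m on; the absolute value and + 1 make the constant
       positive. Starting at 2 makes ln d positive, so that the quotient can be cleared. *)
    exists (`|fine s| + 1), (maxn m 2); split.
    - by rewrite ltr_wpDl.
    - by rewrite leq_maxr.
    move=> d; rewrite geq_max => /andP[md d2].
    have lnd : 0 < ln d%:R :> R by rewrite ln_gt0 ?ltr1n.
    rewrite -ler_pdivrMr// -(big_mkord xpredT gamma).
    have us : (((\sum_(0 <= j < d) gamma j) / ln d%:R)%:E <= s)%E.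
      by apply: ereal_sup_ubound; exists d => //; exact: mA.
    have sfin : s \is a fin_num.
      by rewrite fin_numElt soo andbT (lt_le_trans _ us)// ltNyr.
    rewrite -(fineK sfin) lee_fin in us.
    by rewrite (le_trans us)// (le_trans (ler_norm _))// lerDl.
  pose K := expR (Z * \sum_(j < d0) gamma j).
  have K1 : 1 <= K.
    rewrite -expR0 ler_expR mulr_ge0 ?(ltW Z0)// sumr_ge0// => j _; exact: ltW.
  (* For d >= d0 the exponential is at most exp (Z C ln d) = d^(Z C); the finitely many smaller d
     are absorbed by K. *)
  exists (2 * K), 2, (Z * C); split => //.
  - by rewrite mulr_gt0// expR_gt0.
  - exact: mulr_gt0.
  move=> d e d_gt0 e01; apply: (le_trans (H d e e01)).
  rewrite lee_fin ler_wpM2r ?powR_ge0// -mulrA ler_wpM2l//.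
  have d1 : 1 <= d%:R `^ (Z * C) :> R.
    by rewrite -[leLHS](powRr0 d%:R) ler_powR ?ler1n// ltW// mulr_gt0.
  have [dd0|dd0] := leqP d0 d.
    rewrite -[leLHS]mul1r; apply: ler_pM; rewrite ?expR_ge0//.
    rewrite /powR gt_eqF ?ltr0n// ler_expR -mulrA ler_wpM2l ?(ltW Z0)//.
    exact: HC.
  rewrite -[leLHS]mulr1; apply: ler_pM; rewrite ?expR_ge0//.
  rewrite ler_expR ler_wpM2l ?(ltW Z0)//.
  rewrite -(subnKC (ltnW dd0)) big_split_ord/= lerDl.
  by apply: sumr_ge0 => j _; exact: ltW.
Qed.
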